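(* Let $R$ be one of the chain rings $\mathbb{G}_4=\mathbb{Z}_4[X]/(X^2+X+1)$, $\mathbb{S}_4=\mathbb{F}_4[X]/(X^2)$, $\mathbb{T}_4=\mathbb{F}_4[X;a\mapsto a^2]/(X^2)$. Then (i) $\mathrm{m}_6(R)\le 84$, and (ii) $\mathrm{m}_6(R)<84$ if $R\ne\mathbb{G}_4$.
   Context: $\mathbb{F}_4[X;a\mapsto a^2]$ denotes the skew polynomial ring with commutation rule $Xa=a^2X$. For a finite chain ring $R$ of length $2$ with residue field $\mathbb{F}_q$, the projective Hjelmslev plane $\mathrm{PHG}(2,R)$ is the incidence structure whose points are the free rank-$1$ submodules of the right module $R_R^3$, whose lines are the free rank-$2$ submodules of $R_R^3$, with incidence given by inclusion. A projective $(k,n)$-arc is a set of $k$ points meeting every line in at most $n$ points. For $0\le n\le q^2+q$, $\mathrm{m}_n(R)$ denotes the largest $k$ such that a projective $(k,n)$-arc exists in $\mathrm{PHG}(2,R)$. *)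

(* Defs.v *)
From HB Require Import structures.
From mathcomp Require Import all_boot all_order all_algebra.
From mathcomp Require Import ring.
Set Implicit Arguments. Unset Strict Implicit. Unset Printing Implicit Defensive.
Import GRing.Theory.
Local Open Scope ring_scope.

(* The field F_4 = {0, 1, w, w^2} with w^2 = w + 1.                          *)
Inductive F4 := F4_0 | F4_1 | F4_w | F4_w2.

Definition F4_code (x : F4) : 'I_4 :=
  match x with F4_0 => inord 0 | F4_1 => inord 1 | F4_w => inord 2 | F4_w2 => inord 3 end.
Definition F4_decode (i : 'I_4) : F4 :=
  match val i with 0%N => F4_0 | 1%N => F4_1 | 2%N => F4_w | _ => F4_w2 end.
Lemma F4_codeK : cancel F4_code F4_decode.
Proof. by case; rewrite /F4_decode /= inordK. Qed.

HB.instance Definition _ := Finite.copy F4 (can_type F4_codeK).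

(* addition: F4 as F_2-vector space with basis 1, w *)
Definition F4_add (x y : F4) : F4 :=
  match x, y with
  | F4_0, z | z, F4_0 => z
  | F4_1, F4_1 | F4_w, F4_w | F4_w2, F4_w2 => F4_0
  | F4_1, F4_w | F4_w, F4_1 => F4_w2
  | F4_1, F4_w2 | F4_w2, F4_1 => F4_w
  | F4_w, F4_w2 | F4_w2, F4_w => F4_1
  end.
Definition F4_opp (x : F4) : F4 := x.
Definition F4_mul (x y : F4) : F4 :=
  match x, y with
  | F4_0, _ | _, F4_0 => F4_0
  | F4_1, z | z, F4_1 => z
  | F4_w, F4_w => F4_w2
  | F4_w, F4_w2 | F4_w2, F4_w => F4_1
  | F4_w2, F4_w2 => F4_w
  end.

Lemma F4_addA : associative F4_add. Proof. by move=> [] [] []. Qed.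
Lemma F4_addC : commutative F4_add. Proof. by move=> [] []. Qed.
Lemma F4_add0 : left_id F4_0 F4_add. Proof. by case. Qed.
Lemma F4_addN : left_inverse F4_0 F4_opp F4_add. Proof. by case. Qed.
HB.instance Definition _ := GRing.isZmodule.Build F4 F4_addA F4_addC F4_add0 F4_addN.

Lemma F4_mulA : associative F4_mul. Proof. by move=> [] [] []. Qed.
Lemma F4_mulC : commutative F4_mul. Proof. by move=> [] []. Qed.
Lemma F4_mul1 : left_id F4_1 F4_mul. Proof. by case. Qed.
Lemma F4_mulDl : left_distributive F4_mul F4_add. Proof. by move=> [] [] []. Qed.
Lemma F4_one_neq0 : F4_1 != F4_0. Proof. by apply/eqP. Qed.
HB.instance Definition _ :=
  GRing.Zmodule_isComNzRing.Build F4 F4_mulA F4_mulC F4_mul1 F4_mulDl F4_one_neq0.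

Lemma F4_sqrD (a b : F4) : (a + b) ^+ 2 = a ^+ 2 + b ^+ 2.
Proof. by move: a b => [] []. Qed.

(* G_4 = Z_4[X]/(X^2+X+1): elements a + b*w, a b in Z_4, w^2 = -1 - w.      *)
Record G4 := MkG4 { g4a : 'Z_4; g4b : 'Z_4 }.
Definition G4_to (x : G4) : 'Z_4 * 'Z_4 := (g4a x, g4b x).
Definition G4_of (p : 'Z_4 * 'Z_4) : G4 := MkG4 p.1 p.2.
Lemma G4_toK : cancel G4_to G4_of. Proof. by case. Qed.
HB.instance Definition _ := Finite.copy G4 (can_type G4_toK).

Definition G4_add x y := MkG4 (g4a x + g4a y) (g4b x + g4b y).
Definition G4_opp x := MkG4 (- g4a x) (- g4b x).
Definition G4_zero := MkG4 0 0.
Definition G4_one := MkG4 1 0.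
(* (a + b w)(c + d w) = (ac - bd) + (ad + bc - bd) w *)
Definition G4_mul x y :=
  MkG4 (g4a x * g4a y - g4b x * g4b y)
       (g4a x * g4b y + g4b x * g4a y - g4b x * g4b y).

Lemma G4_addA : associative G4_add.
Proof. by move=> [? ?] [? ?] [? ?]; rewrite /G4_add /= !addrA. Qed.
Lemma G4_addC : commutative G4_add.
Proof. by move=> [a b] [c d]; rewrite /G4_add /= (addrC a) (addrC b). Qed.
Lemma G4_add0 : left_id G4_zero G4_add.
Proof. by move=> [? ?]; rewrite /G4_add /= !add0r. Qed.
Lemma G4_addN : left_inverse G4_zero G4_opp G4_add.
Proof. by move=> [? ?]; rewrite /G4_add /= !addNr. Qed.
HB.instance Definition _ := GRing.isZmodule.Build G4 G4_addA G4_addC G4_add0 G4_addN.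

Lemma G4_mulA : associative G4_mul.
Proof. move=> [a b] [c d] [e f]; rewrite /G4_mul /=; congr MkG4; ring. Qed.
Lemma G4_mulC : commutative G4_mul.
Proof. move=> [a b] [c d]; rewrite /G4_mul /=; congr MkG4; ring. Qed.
Lemma G4_mul1 : left_id G4_one G4_mul.
Proof. move=> [a b]; rewrite /G4_mul /=; congr MkG4; ring. Qed.
Lemma G4_mulDl : left_distributive G4_mul G4_add.
Proof. move=> [a b] [c d] [e f]; rewrite /G4_mul /G4_add /=; congr MkG4; ring. Qed.
Lemma G4_one_neq0 : G4_one != G4_zero. Proof. by apply/eqP. Qed.
HB.instance Definition _ :=
  GRing.Zmodule_isComNzRing.Build G4 G4_mulA G4_mulC G4_mul1 G4_mulDl G4_one_neq0.

(* S_4 = F_4[X]/(X^2): elements a + b X, (a + bX)(c + dX) = ac + (ad + bc)X. *)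
Record S4 := MkS4 { s4a : F4; s4b : F4 }.
Definition S4_to (x : S4) : F4 * F4 := (s4a x, s4b x).
Definition S4_of (p : F4 * F4) : S4 := MkS4 p.1 p.2.
Lemma S4_toK : cancel S4_to S4_of. Proof. by case. Qed.
HB.instance Definition _ := Finite.copy S4 (can_type S4_toK).

Definition S4_add x y := MkS4 (s4a x + s4a y) (s4b x + s4b y).
Definition S4_opp x := MkS4 (- s4a x) (- s4b x).
Definition S4_zero := MkS4 0 0.
Definition S4_one := MkS4 1 0.
Definition S4_mul x y :=
  MkS4 (s4a x * s4a y) (s4a x * s4b y + s4b x * s4a y).

Lemma S4_addA : associative S4_add.
Proof. by move=> [? ?] [? ?] [? ?]; rewrite /S4_add /= !addrA. Qed.
Lemma S4_addC : commutative S4_add.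
Proof. move=> [a b] [c d]; rewrite /S4_add /=; congr MkS4; ring. Qed.
Lemma S4_add0 : left_id S4_zero S4_add.
Proof. by move=> [? ?]; rewrite /S4_add /= !add0r. Qed.
Lemma S4_addN : left_inverse S4_zero S4_opp S4_add.
Proof. by move=> [? ?]; rewrite /S4_add /= !addNr. Qed.
HB.instance Definition _ := GRing.isZmodule.Build S4 S4_addA S4_addC S4_add0 S4_addN.

Lemma S4_mulA : associative S4_mul.
Proof. move=> [a b] [c d] [e f]; rewrite /S4_mul /=; congr MkS4; ring. Qed.
Lemma S4_mulC : commutative S4_mul.
Proof. move=> [a b] [c d]; rewrite /S4_mul /=; congr MkS4; ring. Qed.
Lemma S4_mul1 : left_id S4_one S4_mul.
Proof. move=> [a b]; rewrite /S4_mul /=; congr MkS4; ring. Qed.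
Lemma S4_mulDl : left_distributive S4_mul S4_add.
Proof. move=> [a b] [c d] [e f]; rewrite /S4_mul /S4_add /=; congr MkS4; ring. Qed.
Lemma S4_one_neq0 : S4_one != S4_zero. Proof. by apply/eqP. Qed.
HB.instance Definition _ :=
  GRing.Zmodule_isComNzRing.Build S4 S4_mulA S4_mulC S4_mul1 S4_mulDl S4_one_neq0.

(* T_4 = F_4[X; a |-> a^2]/(X^2), with X a = a^2 X: elements a + b X,        *)
(* (a + bX)(c + dX) = ac + (ad + b c^2) X.                                   *)
Record T4 := MkT4 { t4a : F4; t4b : F4 }.
Definition T4_to (x : T4) : F4 * F4 := (t4a x, t4b x).
Definition T4_of (p : F4 * F4) : T4 := MkT4 p.1 p.2.
Lemma T4_toK : cancel T4_to T4_of. Proof. by case. Qed.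
HB.instance Definition _ := Finite.copy T4 (can_type T4_toK).

Definition T4_add x y := MkT4 (t4a x + t4a y) (t4b x + t4b y).
Definition T4_opp x := MkT4 (- t4a x) (- t4b x).
Definition T4_zero := MkT4 0 0.
Definition T4_one := MkT4 1 0.
Definition T4_mul x y :=
  MkT4 (t4a x * t4a y) (t4a x * t4b y + t4b x * (t4a y) ^+ 2).

Lemma T4_addA : associative T4_add.
Proof. by move=> [? ?] [? ?] [? ?]; rewrite /T4_add /= !addrA. Qed.
Lemma T4_addC : commutative T4_add.
Proof. move=> [a b] [c d]; rewrite /T4_add /=; congr MkT4; ring. Qed.
Lemma T4_add0 : left_id T4_zero T4_add.
Proof. by move=> [? ?]; rewrite /T4_add /= !add0r. Qed.
Lemma T4_addN : left_inverse T4_zero T4_opp T4_add.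
Proof. by move=> [? ?]; rewrite /T4_add /= !addNr. Qed.
HB.instance Definition _ := GRing.isZmodule.Build T4 T4_addA T4_addC T4_add0 T4_addN.

Lemma T4_mulA : associative T4_mul.
Proof. move=> [a b] [c d] [e f]; rewrite /T4_mul /=; congr MkT4; ring. Qed.
Lemma T4_mul1 : left_id T4_one T4_mul.
Proof. move=> [a b]; rewrite /T4_mul /=; congr MkT4; ring. Qed.
Lemma T4_mulr1 : right_id T4_one T4_mul.
Proof. move=> [a b]; rewrite /T4_mul /=; congr MkT4; ring. Qed.
Lemma T4_mulDl : left_distributive T4_mul T4_add.
Proof. move=> [a b] [c d] [e f]; rewrite /T4_mul /T4_add /=; congr MkT4; ring. Qed.
Lemma T4_mulDr : right_distributive T4_mul T4_add.
Proof.
move=> [a b] [c d] [e f]; rewrite /T4_mul /T4_add /= F4_sqrD; congr MkT4; ring.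
Qed.
Lemma T4_one_neq0 : T4_one != T4_zero. Proof. by apply/eqP. Qed.
HB.instance Definition _ :=
  GRing.Zmodule_isNzRing.Build T4 T4_mulA T4_mul1 T4_mulr1 T4_mulDl T4_mulDr T4_one_neq0.

Lemma T4_noncomm : T4_mul (MkT4 0 1) (MkT4 F4_w 0) != T4_mul (MkT4 F4_w 0) (MkT4 0 1).
Proof. by apply/eqP; rewrite /T4_mul /=; case. Qed.

(* The projective Hjelmslev plane PHG(2,R) over a finite ring R, built on    *)
(* the RIGHT module R_R^3 (row vectors, scalars acting on the right).        *)
Section PHG.
Variable R : finNzRingType.

Definition vec := 'rV[R]_3.

Definition rscale (v : vec) (r : R) : vec := \row_i (v 0 i * r).

(* P is a free rank-1 submodule of R_R^3: P = xR with {x} a basis,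
   i.e. r |-> x r injective. *)
Definition is_point (P : {set vec}) : bool :=
  [exists x : vec, injectiveb (rscale x) && (P == [set rscale x r | r : R])].

(* L is a free rank-2 submodule of R_R^3: L = xR + yR with {x, y} a basis,
   i.e. (r, s) |-> x r + y s injective. *)
Definition is_line (L : {set vec}) : bool :=
  [exists x : vec, exists y : vec,
     injectiveb (fun rs : R * R => rscale x rs.1 + rscale y rs.2)
     && (L == [set rscale x rs.1 + rscale y rs.2 | rs : R * R])].

Definition is_arc (n : nat) (A : {set {set vec}}) : bool :=
  [forall P in A, is_point P] &&
  [forall L : {set vec}, is_line L ==> (#|[set P in A | P \subset L]| <= n)%N].

Definition m_arc (n : nat) : nat := \max_(A : {set {set vec}} | is_arc n A) #|A|.

End PHG.

(* Main.v *)
Require Import Defs.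
From mathcomp Require Import all_boot all_order all_algebra.
From mathcomp Require Import zify ring.
Set Implicit Arguments. Unset Strict Implicit. Unset Printing Implicit Defensive.

(* The points fall into 21 neighbour classes, the points of a PG(2,4), each an
   affine plane AG(2,4) of 16 points cut by the lines of the five incident line
   classes into segments; dually the 16 lines of a line class form an AG(2,4)
   whose lines are the 20 segments of its five point classes.

   Let an arc have 84 points, n in a given class and w on a given segment. The
   four lines through a segment of a line class with N points give
   N - n + 4w <= 24. Together with the identity n^2 + 4n for the sum of the w^2
   over the segments of a class this forces n <= 6 and determines the segment
   counts of the classes with n = 5, 6. A finite search lists the line classes
   with N > 20: their point counts are 54444, 55533, 64444, 64443 or 66333. In all
   other line classes the sum of w^2 - 1 over the segments of the classes with
   n = 4 is essentially at most 12, whereas each class with n = 4 needs exactly 12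
   over its five directions; counting classes against line classes in PG(2,4)
   then rules out n > 4. So every class of an 84-arc has exactly four points, and
   since some class of an 85-arc has five, 85-arcs do not exist.

   When all n = 4 the same second moment computation makes every line meet the
   arc in 2 or 6 points. The rings S_4 and T_4 contain F_4, hence the plane
   contains a subplane PG(2,4), and every point is on one or five of its 21 lines.
   Counting the incidences of the arc with these lines modulo 4 gives the
   contradiction 84 = 21 * 2 mod 4. *)

(** * Segment counts in one class of neighbouring lines *)

(* With F_4 = {0, 1, w, w^2} coded as 0, 1, 2, 3, the point (x, y) of AG(2,4) has
   index 4x + y, and the rows are its labels x, y, y + x, y + w x, y + w^2 x in the
   five parallel classes. *)
Definition dir_table : seq (seq nat) :=
  [:: [:: 0; 0; 0; 0; 1; 1; 1; 1; 2; 2; 2; 2; 3; 3; 3; 3];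
      [:: 0; 1; 2; 3; 0; 1; 2; 3; 0; 1; 2; 3; 0; 1; 2; 3];
      [:: 0; 1; 2; 3; 1; 0; 3; 2; 2; 3; 0; 1; 3; 2; 1; 0];
      [:: 0; 1; 2; 3; 2; 3; 0; 1; 3; 2; 1; 0; 1; 0; 3; 2];
      [:: 0; 1; 2; 3; 3; 2; 1; 0; 1; 0; 3; 2; 2; 3; 0; 1]].

Definition dirv (j m : nat) : nat := nth 0 (nth [::] dir_table j) m.

Definition class_sum (w : nat -> nat -> nat) j := w j 0 + w j 1 + w j 2 + w j 3.
Definition class_sqr (w : nat -> nat -> nat) j :=
  w j 0 ^ 2 + w j 1 ^ 2 + w j 2 ^ 2 + w j 3 ^ 2.
Definition total (w : nat -> nat -> nat) :=
  class_sum w 0 + class_sum w 1 + class_sum w 2 + class_sum w 3 + class_sum w 4.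
Definition line_sum (w : nat -> nat -> nat) m :=
  w 0 (dirv 0 m) + w 1 (dirv 1 m) + w 2 (dirv 2 m) + w 3 (dirv 3 m)
  + w 4 (dirv 4 m).
Definition capped (w : nat -> nat -> nat) := forall m, m < 16 -> line_sum w m <= 6.

Definition segment (j s : nat) : seq nat := [seq m <- iota 0 16 | dirv j m == s].

(** Two segments of different classes lie on exactly one common line of the line class. The four
    lines through segment [s] of class [j] therefore meet each segment of every other class once. *)
Lemma segment_sum w j s : j < 5 -> s < 4 ->
  \sum_(m <- segment j s) line_sum w m + class_sum w j = total w + 4 * w j s.
Proof.
case: j => [|[|[|[|[|//]]]]] _; case: s => [|[|[|[|//]]]] _;
  rewrite /segment /= !big_cons big_nil /line_sum /total /class_sum /dirv /=; lia.
Qed.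

Lemma segment_lt j s m : m \in segment j s -> m < 16.
Proof. by rewrite mem_filter mem_iota => /andP[_]. Qed.

Lemma size_segment j s : j < 5 -> s < 4 -> size (segment j s) = 4.
Proof. by case: j => [|[|[|[|[|//]]]]] _; case: s => [|[|[|[|//]]]]. Qed.

Lemma dirv_lt j m : j < 5 -> m < 16 -> dirv j m < 4.
Proof.
have /allP H : all (fun j => all (fun m => dirv j m < 4) (iota 0 16)) (iota 0 5) by [].
by move=> Hj Hm; move: (H j); rewrite mem_iota => /(_ Hj)/allP/(_ m); rewrite mem_iota; apply.
Qed.

Lemma segment_bound w j s : capped w -> j < 5 -> s < 4 ->
  total w + 4 * w j s <= 24 + class_sum w j.
Proof.
move=> H Hj Hs; rewrite -segment_sum // leq_add2r.
suff : \sum_(m <- segment j s) line_sum w m <= \sum_(m <- segment j s) 6.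
  by rewrite big_const_seq count_predT iter_addn_0 size_segment.
by rewrite big_seq [leqRHS]big_seq; apply: leq_sum => m /segment_lt/H.
Qed.

(** Each segment lies on four lines, two segments of different classes on one, and two segments of
    the same class on none. The mixed products thus add up to [total w ^ 2] minus the squares of the
    class sums. *)
Lemma second_moment w :
  \sum_(0 <= m < 16) line_sum w m ^ 2 +
    (class_sum w 0 ^ 2 + class_sum w 1 ^ 2 + class_sum w 2 ^ 2 +
     class_sum w 3 ^ 2 + class_sum w 4 ^ 2) =
  4 * (class_sqr w 0 + class_sqr w 1 + class_sqr w 2 + class_sqr w 3 +
       class_sqr w 4) + total w ^ 2.
Proof.
rewrite /index_iota subn0 /= !big_cons big_nil.
rewrite /line_sum /total /class_sum /class_sqr /dirv /=.
ring.
Qed.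

(** * Deficits of the lines of a line class *)

Definition pencil (m0 j : nat) : seq nat :=
  [seq m <- iota 0 16 | (dirv j m == dirv j m0) && (m != m0)].

(** Two of the sixteen lines share exactly one segment, so the lines other than [m0] split into five
    triples. *)
Lemma pencil_partition m0 : m0 < 16 ->
  perm_eq (iota 0 16) (m0 :: flatten [seq pencil m0 j | j <- iota 0 5]).
Proof.
have : all (fun m0 => perm_eq (iota 0 16)
  (m0 :: flatten [seq pencil m0 j | j <- iota 0 5])) (iota 0 16) by vm_compute.
by move=> /allP H Hm; apply: H; rewrite mem_iota.
Qed.

Lemma sum_sqr_le (s : seq nat) (h : nat -> nat) :
  \sum_(m <- s) h m ^ 2 <= (\sum_(m <- s) h m) ^ 2.
Proof.
elim: s => [|m s IH]; first by rewrite !big_nil.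
by rewrite !big_cons; move: IH; move: (\sum_(_ <- _) _) (\sum_(_ <- _) _) (h m); nia.
Qed.

Lemma pencil_sqr_bound (h : nat -> nat) m0 : m0 < 16 ->
  \sum_(0 <= m < 16) h m ^ 2 <=
  h m0 ^ 2 + \sum_(0 <= j < 5) (\sum_(m <- pencil m0 j) h m) ^ 2.
Proof.
move=> Hm; rewrite /index_iota !subn0 (perm_big _ (pencil_partition Hm)) .
rewrite big_cons leq_add2l big_flatten big_map.
by apply: leq_sum => j _; apply: sum_sqr_le.
Qed.

Lemma pencil_segment m0 j : m0 < 16 -> perm_eq (m0 :: pencil m0 j) (segment j (dirv j m0)).
Proof.
move=> Hm; apply: uniq_perm; rewrite /= ?filter_uniq ?iota_uniq //.
  by rewrite mem_filter !eqxx.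
move=> m; rewrite inE !mem_filter mem_iota.
by case: (eqVneq m m0) => [->|]; rewrite ?eqxx ?Hm //= andbT.
Qed.

Lemma pencil_line_sum w h m0 j :
  (forall m, m < 16 -> h m + line_sum w m = 6) -> m0 < 16 -> j < 5 ->
  \sum_(m <- pencil m0 j) h m + h m0 + total w + 4 * w j (dirv j m0)
  = 24 + class_sum w j.
Proof.
move=> H Hm Hj.
have Hs := dirv_lt Hj Hm.
have : \sum_(m <- segment j (dirv j m0)) (h m + line_sum w m) = 24.
  rewrite (eq_big_seq (fun=> 6)); last by move=> m /segment_lt; apply: H.
  by rewrite big_const_seq count_predT iter_addn_0 size_segment.
rewrite big_split /= -(perm_big _ (pencil_segment j Hm)) big_cons /=.
by have := segment_sum w Hj Hs; lia.
Qed.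

Lemma sum_nat5 (F : nat -> nat) :
  \sum_(0 <= j < 5) F j = F 0 + F 1 + F 2 + F 3 + F 4.
Proof. by rewrite /index_iota subn0 /= !big_cons big_nil; lia. Qed.

(** The number [r j] is the total deficit of the three lines sharing with [m0] its segment in class
    [j]; the segment equation fixes it. This handles deficits above 4, where [h ^ 2 <= 4 * h]
    fails. *)
Lemma deficit_sqr_bound w h m0 :
  (forall m, m < 16 -> h m + line_sum w m = 6) -> m0 < 16 ->
  exists r : nat -> nat,
    (forall j, j < 5 ->
       r j + h m0 + total w + 4 * w j (dirv j m0) = 24 + class_sum w j) /\
    \sum_(0 <= m < 16) h m ^ 2 <=
      h m0 ^ 2 + (r 0 ^ 2 + r 1 ^ 2 + r 2 ^ 2 + r 3 ^ 2 + r 4 ^ 2).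
Proof.
move=> Hh Hm0; exists (fun j => \sum_(m <- pencil m0 j) h m); split.
  by move=> j; apply: pencil_line_sum.
by have := pencil_sqr_bound h Hm0; rewrite sum_nat5.
Qed.

Lemma line_sum_total w : \sum_(0 <= m < 16) line_sum w m = 4 * total w.
Proof.
rewrite /index_iota subn0 /= !big_cons big_nil.
rewrite /line_sum /total /class_sum /dirv /=; lia.
Qed.

Lemma deficit_sqr w h : (forall m, m < 16 -> h m + line_sum w m = 6) ->
  \sum_(0 <= m < 16) line_sum w m ^ 2 + 576
    = \sum_(0 <= m < 16) h m ^ 2 + 48 * total w.
Proof.
move=> H.
suff : \sum_(0 <= m < 16) (line_sum w m ^ 2 + 36) =
       \sum_(0 <= m < 16) (h m ^ 2 + 12 * line_sum w m).
  have D : \sum_(0 <= m < 16) 12 * line_sum w m = 12 * (4 * total w).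
    by rewrite -line_sum_total big_distrr.
  by rewrite [X in X = _]big_split [X in _ = X]big_split /= D sum_nat_const_nat => ?; lia.
by apply: eq_big_nat => m /andP[_ /H]; nia.
Qed.

Definition total_sqr (w : nat -> nat -> nat) :=
  class_sqr w 0 + class_sqr w 1 + class_sqr w 2 + class_sqr w 3 + class_sqr w 4.

Lemma small_deficits_sqr (h : nat -> nat) :
  (forall m, m < 16 -> h m <= 4) ->
  \sum_(0 <= m < 16) h m ^ 2 <= 4 * \sum_(0 <= m < 16) h m /\
  (\sum_(0 <= m < 16) h m ^ 2 = 4 * \sum_(0 <= m < 16) h m ->
   forall m, m < 16 -> h m = 0 \/ h m = 4).
Proof.
move=> Hh.
have E : \sum_(0 <= m < 16) h m ^ 2 + \sum_(0 <= m < 16) h m * (4 - h m)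
       = 4 * \sum_(0 <= m < 16) h m.
  rewrite -big_split big_distrr /=; apply: eq_big_nat => m /andP[_ /Hh]; nia.
split=> [|E2]; first by lia.
have /eqP : \sum_(0 <= m < 16) h m * (4 - h m) = 0 by lia.
rewrite sum_nat_seq_eq0 => /allP H m Hm; move: (H m) (Hh m Hm).
by rewrite mem_index_iota Hm => /(_ isT) /=; nia.
Qed.

Lemma deficit_total w h : (forall m, m < 16 -> h m + line_sum w m = 6) ->
  \sum_(0 <= m < 16) h m + 4 * total w = 96.
Proof.
move=> H; rewrite -line_sum_total -big_split /=.
rewrite (eq_big_nat _ _ (F2 := fun=> 6)); first by rewrite sum_nat_const_nat.
by move=> m /andP[_]; exact: H.
Qed.

Lemma deficit_dec (h : nat -> nat) :
  (exists2 m, m < 16 & 4 < h m) \/ (forall m, m < 16 -> h m <= 4).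
Proof.
case: (boolP (has (fun m => 4 < h m) (iota 0 16))).
  by case/hasP=> m; rewrite mem_iota => ? ?; left; exists m.
move/hasPn=> H; right=> m Hm; rewrite leqNgt; apply: H.
by rewrite mem_iota.
Qed.

Lemma capped_deficit w : capped w ->
  exists h : nat -> nat, forall m, m < 16 -> h m + line_sum w m = 6.
Proof. by move=> H; exists (fun m => 6 - line_sum w m) => m /H; lia. Qed.

(** The deficits sum to 16, and [4 * total_sqr w] is 64 plus the sum of their squares. Deficits of
    at most 4 have squares summing to at most 64, with equality only for the values 0 and 4. *)
Lemma five_fours w : capped w -> (forall j, j < 5 -> class_sum w j = 4) ->
  total_sqr w <= 32 /\
  (total_sqr w = 32 -> forall m, m < 16 -> line_sum w m = 2 \/ line_sum w m = 6).
Proof.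
move=> H Hn; have [h Hh] := capped_deficit H.
have T : total w = 20 by rewrite /total !Hn.
have := second_moment w; have := deficit_sqr Hh; have := deficit_total Hh.
rewrite -/(total_sqr w) T !Hn //.
case: (deficit_dec h) => [[m0 Hm0 h0]|/small_deficits_sqr[]]; last first.
  move=> ? K ? ? ?; split; first by lia.
  move=> E m Hm; have := Hh m Hm; have [||] := K _ m Hm; lia.
(* A deficit above 4 makes every segment of [m0] empty. The deficit is then 6, each triple has total
   2, and the squares sum to at most 36 + 20 = 56. *)
have [r [R B]] := deficit_sqr_bound Hh Hm0.
have {}R j : j < 5 -> r j + h m0 + 4 * w j (dirv j m0) = 8.
  by move=> /[dup] Hj /R; rewrite T Hn //; lia.
have Q j : j < 5 -> w j (dirv j m0) = 0 by move/R; lia.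
have L : h m0 = 6 by have := Hh _ Hm0; rewrite /line_sum !Q //; lia.
have {}R j : j < 5 -> r j = 2 by move=> /[dup] /R + /Q; lia.
move: B; rewrite L !R // => B E1 E2 E3.
by split=> [|?]; lia.
Qed.

Lemma class_sqr_ge w j : class_sum w j <= class_sqr w j.
Proof.
have K x : x <= x ^ 2 by nia.
by rewrite /class_sum /class_sqr; do 3!apply: leq_add => //.
Qed.

Lemma class_sqr_odd w j : odd (class_sqr w j) = odd (class_sum w j).
Proof. by rewrite /class_sum /class_sqr !oddD !oddX. Qed.

(** The case of a deficit above 4 when the class sums are 3, 4, 4, 4, 4. For [h = 5] one of [w1],
    ..., [w4] is 1, which gives 25 + 9 + 48 = 82; for [h = 6] all [w] vanish and the value is 76. *)
Lemma deficit_arith h r0 r1 r2 r3 r4 w0 w1 w2 w3 w4 :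
  r0 + h + 4 * w0 = 5 + 3 -> r1 + h + 4 * w1 = 5 + 4 ->
  r2 + h + 4 * w2 = 5 + 4 -> r3 + h + 4 * w3 = 5 + 4 ->
  r4 + h + 4 * w4 = 5 + 4 -> h + (w0 + w1 + w2 + w3 + w4) = 6 -> 4 < h ->
  h ^ 2 + r0 ^ 2 + r1 ^ 2 + r2 ^ 2 + r3 ^ 2 + r4 ^ 2 <= 82.
Proof.
move=> e0 e1 e2 e3 e4 L h0.
have [Eh|Eh] : h = 5 \/ h = 6 by lia.
  have sq r w : r + h + 4 * w = 5 + 4 -> r ^ 2 = 4 * r.
    rewrite Eh => E; have [->|->] : r = 0 \/ r = 4 by lia.
      by [].
    by [].
  have -> : r0 = 3 by lia.
  rewrite (sq _ _ e1) (sq _ _ e2) (sq _ _ e3) (sq _ _ e4) Eh; lia.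
have -> : r0 = 2 by lia.
have -> : r1 = 3 by lia.
have -> : r2 = 3 by lia.
have -> : r3 = 3 by lia.
have -> : r4 = 3 by lia.
by rewrite Eh.
Qed.

(** Here [4 * total_sqr w] is 48 plus the sum of the squared deficits, hence at most 130, so
    [total_sqr w <= 32]. The class of three has square sum at least 3, which leaves 29 for the other
    four classes; their class sums are even, and parity lowers this to 28. *)
Lemma four_fours_and_three w j0 : capped w -> j0 < 5 ->
  (forall j, j < 5 -> class_sum w j = if j == j0 then 3 else 4) ->
  total_sqr w <= class_sqr w j0 + 28.
Proof.
move=> H Hj0 Hn; have [h Hh] := capped_deficit H.
have T : total w = 19 by rewrite /total !Hn //; move: (j0) Hj0; do 5!case=> //.
have N2 : class_sum w 0 ^ 2 + class_sum w 1 ^ 2 + class_sum w 2 ^ 2 +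
     class_sum w 3 ^ 2 + class_sum w 4 ^ 2 = 73.
  by rewrite !Hn //; move: (j0) Hj0; do 5!case=> //.
suff B : \sum_(0 <= m < 16) h m ^ 2 <= 82.
  have := second_moment w; have := deficit_sqr Hh.
  rewrite -/(total_sqr w) T N2 => E1 E2.
  have W : total_sqr w <= 32 by lia.
  have O : odd (total_sqr w) = odd (class_sqr w j0).
    rewrite /total_sqr 4!oddD !class_sqr_odd !Hn //.
    by move: (j0) Hj0; do 5!case=> //.
  have := class_sqr_ge w j0; rewrite (Hn _ Hj0) eqxx => C.
  have : total_sqr w - class_sqr w j0 <= 29 by lia.
  have : odd (total_sqr w - class_sqr w j0) = false.
    by rewrite oddB ?O ?addbb //; move: (j0) Hj0; do 5?case=> //; rewrite /total_sqr; lia.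
  by move: (_ - _) => d O' D'; lia.
have := deficit_total Hh; rewrite T => S.
case: (deficit_dec h) => [[m0 Hm0 h0]|/small_deficits_sqr[B _]]; last by lia.
have [r [R B]] := deficit_sqr_bound Hh Hm0; apply: leq_trans B _.
have L := Hh _ Hm0; rewrite /line_sum in L.
have {}R j : j < 5 -> r j + h m0 + 4 * w j (dirv j m0) = 5 + (if j == j0 then 3 else 4).
  by move=> /[dup] Hj /R; rewrite T Hn //; lia.
have := R 0 isT; have := R 1 isT; have := R 2 isT; have := R 3 isT; have := R 4 isT.
by move: L Hj0 h0; case: (j0) => [|[|[|[|[|//]]]]] L _ h0 /= e4 e3 e2 e1 e0;
   [have := deficit_arith e0 e1 e2 e3 e4 | have := deficit_arith e1 e0 e2 e3 e4
   |have := deficit_arith e2 e0 e1 e3 e4 | have := deficit_arith e3 e0 e1 e2 e4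
   |have := deficit_arith e4 e0 e1 e2 e3];
   move: (r 0 ^ 2) (r 1 ^ 2) (r 2 ^ 2) (r 3 ^ 2) (r 4 ^ 2) (h m0 ^ 2) L => *; lia.
Qed.

(** * Line classes with more than twenty points *)

Definition seg_row (w : nat -> nat -> nat) j : seq nat := [seq w j s | s <- iota 0 4].

Lemma sumn_row w j : sumn (seg_row w j) = class_sum w j.
Proof. by rewrite /seg_row /class_sum /=; lia. Qed.

(** The list [fs] holds partial sums on the sixteen lines, [dirs] the labels of these lines in the
    class being added, and [r] its four segment counts. *)
Fixpoint add_row (dirs fs r : seq nat) : seq nat :=
  match dirs, fs with
  | a :: dirs', b :: fs' => nth 0 r a + b :: add_row dirs' fs' r
  | _, _ => [::]
  end.

Fixpoint add_rows (dirss fss : seq (seq nat)) (fs : seq nat) : seq nat :=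
  match dirss, fss with
  | dirs :: dirss', r :: rs' => add_rows dirss' rs' (add_row dirs fs r)
  | _, _ => fs
  end.

Lemma lebE x y : Nat.leb x y = (x <= y).
Proof. by elim: x y => [|x IH] [|y] //=; rewrite IH. Qed.

Definition le6 (fs : seq nat) : bool := all (fun x => Nat.leb x 6) fs.

Section Search.
Variables (opts : seq (seq nat)) (lo hi : nat) (good : seq nat -> bool).

(** A branch is cut when a partial line sum exceeds 6 or the total can no longer end between [lo]
    and [hi], with at most 6 points in each class still to come. The class sums are collected in
    [ns] in reverse order. *)
Fixpoint search (dirss : seq (seq nat)) (fs ns : seq nat) (t : nat) : bool :=
  match dirss with
  | [::] => good ns
  | dirs :: dirss' =>
      all (fun r =>
        let n := sumn r in
        if Nat.leb (n + t) hi && Nat.leb lo (n + t + 6 * size dirss') then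
          let fs' := add_row dirs fs r in
          if le6 fs' then search dirss' fs' (n :: ns) (n + t) else true
        else true) opts
  end.

Lemma le6_add_row dirs fs r : size fs <= size dirs ->
  le6 (add_row dirs fs r) -> le6 fs.
Proof.
elim: dirs fs => [|a dirs IH] [|b fs] //= sz /andP[H /IH ->] //.
by rewrite andbT; move: H; rewrite !lebE; lia.
Qed.

Lemma size_add_row dirs fs r : size fs = size dirs ->
  size (add_row dirs fs r) = size dirs.
Proof. by elim: dirs fs => [|a dirs IH] [|b fs] //= [/IH ->]. Qed.

Lemma le6_add_rows n dirss rs fs : size fs = n ->
  all (fun d => size d == n) dirss ->
  le6 (add_rows dirss rs fs) -> le6 fs.
Proof.
elim: dirss rs fs => [|d dirss IH] [|r rs] //= fs sz /andP[/eqP sd sds] H.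
have := IH _ _ _ sds H; rewrite size_add_row ?sd // => /(_ erefl).
by apply: le6_add_row; rewrite sz sd.
Qed.

(** Line sums only grow as rows are added, and each row sums to at most 6, so no test cuts the
    branch that contains [rs]. *)
Lemma search_sound n dirss fs ns t rs :
  search dirss fs ns t -> size fs = n -> all (fun d => size d == n) dirss ->
  all (fun r => sumn r <= 6) opts ->
  size rs = size dirss -> all (mem opts) rs ->
  lo <= t + sumn (map sumn rs) <= hi -> le6 (add_rows dirss rs fs) ->
  good (catrev (map sumn rs) ns).
Proof.
move=> + + + o6; elim: dirss fs ns t rs => [|d dirss IH] fs ns t [|r rs] //=.
move=> /allP S sz /andP[/eqP sd sds] [szr] /andP[ro rso] /andP[tlo thi] H.
have b6 : sumn (map sumn rs) <= 6 * size dirss.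
  rewrite -szr; elim: rs {szr H tlo thi} rso => //= a rs IHr /andP[ao /IHr].
  by have := allP o6 _ ao => /=; lia.
have h6 : le6 (add_row d fs r).
  by apply: le6_add_rows H => //; rewrite size_add_row sd.
move: (S _ ro); rewrite h6.
rewrite !lebE (_ : _ && _); last by apply/andP; split; lia.
move=> /= /IH; apply=> //; first by rewrite size_add_row sd.
by apply/andP; split; lia.
Qed.

End Search.

Definition root_search opts lo hi good (first : seq nat) : bool :=
  search opts lo hi good (behead dir_table)
    (add_row (head [::] dir_table) (nseq 16 0) first) [:: sumn first] (sumn first).

Definition class_sums w : seq nat := [seq class_sum w j | j <- iota 0 5].

Lemma root_search_sound opts lo hi good first w :
  root_search opts lo hi good first -> all (fun r => sumn r <= 6) opts ->
  capped w -> seg_row w 0 = first -> (forall j, 0 < j < 5 -> seg_row w j \in opts) ->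
  lo <= total w <= hi -> good (rev (class_sums w)).
Proof.
move=> S o6 H w0 wo T.
have E : map sumn [seq seg_row w j | j <- iota 1 4] = [seq class_sum w j | j <- iota 1 4].
  by rewrite -map_comp; apply: eq_map => j; apply: sumn_row.
have -> : rev (class_sums w) =
    catrev (map sumn [seq seg_row w j | j <- iota 1 4]) [:: sumn first].
  by rewrite E -w0 sumn_row.
apply: (search_sound (n := 16) S) => //; rewrite -?w0.
- by rewrite /= !wo.
- by move: T; rewrite E sumn_row /total /=; lia.
- apply/allP => x; rewrite lebE.
  have -> : add_rows (behead dir_table) [seq seg_row w j | j <- iota 1 4]
      (add_row (head [::] dir_table) (nseq 16 0) (seg_row w 0))
      = [seq line_sum w m | m <- iota 0 16].
    rewrite /line_sum /dirv /=.
    by do 16?[congr cons; first by lia].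
  by case/mapP=> m; rewrite mem_iota => /H Hm ->.
Qed.

(** Once the total exceeds 20, [segment_bound] leaves only 0/1 rows for a class of at most four
    points. *)
Definition light_rows : seq (seq nat) :=
  [seq [:: p.1.1; p.1.2; p.2.1; p.2.2]
  | p <- [seq (q, r) | q <- [:: (0, 0); (0, 1); (1, 0); (1, 1)],
                       r <- [:: (0, 0); (0, 1); (1, 0); (1, 1)]]].
Definition row5 : seq nat := [:: 2; 2; 1; 0].
Definition row6 : seq nat := [:: 2; 2; 2; 0].
Definition heavy_rows : seq (seq nat) := permutations row6 ++ permutations row5.

Definition high_type (ns : seq nat) : bool :=
  [|| perm_eq ns [:: 5; 4; 4; 4; 4], perm_eq ns [:: 5; 5; 5; 3; 3],
      perm_eq ns [:: 6; 4; 4; 4; 4], perm_eq ns [:: 6; 4; 4; 4; 3]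
    | perm_eq ns [:: 6; 6; 3; 3; 3]].

(** A segment with two points in a class of [n] points gives [total w <= 16 + n]. This is where the
    upper limits 21 and 22 come from. *)
Lemma search5 : root_search (heavy_rows ++ light_rows) 21 21 high_type row5.
Proof. by vm_compute. Qed.
Lemma search6 : root_search (heavy_rows ++ light_rows) 21 22 high_type row6.
Proof. by vm_compute. Qed.
Lemma search50 : root_search (nseq 4 0 :: permutations row5) 20 20 (fun=> false) row5.
Proof. by vm_compute. Qed.

(** * Affine normal forms for the search *)

Definition add4 (a b : nat) : nat :=
  nth 0 (nth [::] [:: [:: 0; 1; 2; 3]; [:: 1; 0; 3; 2]; [:: 2; 3; 0; 1];
                      [:: 3; 2; 1; 0]] a) b.
Definition mul4 (a b : nat) : nat :=
  nth 0 (nth [::] [:: [:: 0; 0; 0; 0]; [:: 0; 1; 2; 3]; [:: 0; 2; 3; 1];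
                      [:: 0; 3; 1; 2]] a) b.

(* The affine map that carries parallel class 0 onto class k, acting on its four
   labels by s |-> a s + b. *)
Definition affine_map (k a b m : nat) : nat :=
  let x := add4 (mul4 a (m %/ 4)) b in
  let y := m %% 4 in
  if k is t.+1 then 4 * y + add4 x (mul4 t y) else 4 * x + y.

Definition inv4 (a : nat) : nat := nth 0 [:: 0; 1; 3; 2] a.
Definition dir_image (k a j : nat) : nat :=
  match k, j with
  | 0, 0 => 0
  | 0, u.+1 => (mul4 u (inv4 a)).+1
  | _, 0 => k
  | _, 1 => 0
  | t.+1, u.+1 => (add4 t (mul4 a (inv4 u))).+1
  end.
Definition seg_image (k a b j s : nat) : nat :=
  match k, j with
  | _, 0 => add4 (mul4 a s) b
  | 0, u.+1 => add4 s (mul4 (mul4 u (inv4 a)) b)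
  | _, 1 => s
  | _, u.+1 => add4 (mul4 (mul4 a (inv4 u)) s) b
  end.

Lemma affine_symmetry : all (fun k => all (fun a => all (fun b =>
    [&& perm_eq [seq dir_image k a j | j <- iota 0 5] (iota 0 5),
        all (fun j => perm_eq [seq seg_image k a b j s | s <- iota 0 4] (iota 0 4))
            (iota 0 5),
        all (fun j => all (fun m =>
              seg_image k a b j (dirv j m) == dirv (dir_image k a j) (affine_map k a b m))
            (iota 0 16)) (iota 0 5)
      & all (fun m => affine_map k a b m < 16) (iota 0 16)])
  (iota 0 4)) (iota 1 3)) (iota 0 5).
Proof. by vm_compute. Qed.

Lemma line_sumE w m : line_sum w m = \sum_(j <- iota 0 5) w j (dirv j m).
Proof. by rewrite /line_sum /= !big_cons big_nil; lia. Qed.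

Lemma perm_class_sums w w' (rho : nat -> nat) :
  perm_eq [seq rho j | j <- iota 0 5] (iota 0 5) ->
  (forall j, j < 5 -> perm_eq (seg_row w' j) (seg_row w (rho j))) ->
  perm_eq (class_sums w') (class_sums w).
Proof.
move=> Hr H; apply: (@perm_trans _ [seq class_sum w j | j <- [seq rho j | j <- iota 0 5]]).
  rewrite -map_comp; suff -> : class_sums w' = [seq (class_sum w \o rho) j | j <- iota 0 5] by [].
  by apply/eq_in_map => j; rewrite mem_iota => /H /perm_sumn; rewrite !sumn_row.
exact: perm_map.
Qed.

(** Counts are pulled back along an affine map of the sixteen lines, which preserves the cap and
    permutes classes and segments. Class [k] becomes the first one. *)
Lemma normal_position w k a b : k < 5 -> 0 < a < 4 -> b < 4 -> capped w ->
  exists w', [/\ capped w', perm_eq (class_sums w') (class_sums w),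
    seg_row w' 0 = [seq w k (add4 (mul4 a s) b) | s <- iota 0 4] &
    forall j, j < 5 -> exists2 j', j' < 5 & perm_eq (seg_row w' j) (seg_row w j')].
Proof.
move=> Hk Ha Hb H.
have /allP/(_ k) := affine_symmetry; rewrite mem_iota => /(_ Hk)/allP/(_ a).
rewrite mem_iota => /(_ Ha)/allP/(_ b); rewrite mem_iota => /(_ Hb).
move=> /and4P[p5 /allP p4 /allP pV /allP g16].
set g := affine_map k a b in pV g16; set rho := dir_image k a in p5 pV.
set sg := seg_image k a b in p4 pV.
pose w' j s := w (rho j) (sg j s).
have rw j : j < 5 -> perm_eq (seg_row w' j) (seg_row w (rho j)).
  move=> Hj; rewrite /seg_row /w' (map_comp (w _) (sg j)); apply: perm_map.
  by apply: p4; rewrite mem_iota.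
exists w'; split.
- move=> m Hm; have gm : g m < 16 by apply: g16; rewrite mem_iota.
  suff -> : line_sum w' m = line_sum w (g m) by apply: H.
  rewrite !line_sumE -[RHS](perm_big _ p5) big_map; apply: eq_big_seq => j Hj.
  rewrite /w'; congr (w _ _); apply/eqP.
  by have /allP/(_ m) := pV _ Hj; rewrite mem_iota => /(_ Hm).
- exact: perm_class_sums p5 rw.
- by apply: eq_map => s; rewrite /w' /rho /sg; case: (k).
- move=> j Hj; exists (rho j); last exact: rw.
  suff : rho j \in iota 0 5 by rewrite mem_iota.
  by rewrite -(perm_mem p5); apply: map_f; rewrite mem_iota.
Qed.

Lemma affine_bij a b : 0 < a < 4 -> b < 4 ->
  perm_eq [seq add4 (mul4 a s) b | s <- iota 0 4] (iota 0 4).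
Proof. by case: a => [|[|[|[|//]]]] // _; case: b => [|[|[|[|//]]]]. Qed.

Lemma row_nth w j s : s < 4 -> nth 0 (seg_row w j) s = w j s.
Proof. by move=> Hs; rewrite (nth_map 0) ?size_iota // nth_iota. Qed.

(** The maps [s |-> a s + b] form the alternating group on four labels, which is transitive on the
    12 arrangements of [row5] and on the 4 of [row6]. *)
Lemma sorting_affine r' r : r = row5 \/ r = row6 -> perm_eq r' r ->
  exists a b, [/\ 0 < a < 4, b < 4 & [seq nth 0 r' (add4 (mul4 a s) b) | s <- iota 0 4] = r].
Proof.
move=> Hr; rewrite -mem_permutations => Hr'.
suff /allP/(_ _ Hr')/hasP[a Ha /hasP[b Hb /eqP E]] : all (fun r' => has (fun a =>
    has (fun b => [seq nth 0 r' (add4 (mul4 a s) b) | s <- iota 0 4] == r)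
    (iota 0 4)) (iota 1 3)) (permutations r).
  by exists a, b; rewrite !mem_iota in Ha Hb.
by case: Hr => ->; vm_compute.
Qed.

Lemma sorted_position w k r : k < 5 -> capped w -> r = row5 \/ r = row6 ->
  perm_eq (seg_row w k) r ->
  exists w', [/\ capped w', perm_eq (class_sums w') (class_sums w), seg_row w' 0 = r &
    forall j, j < 5 -> exists2 j', j' < 5 & perm_eq (seg_row w' j) (seg_row w j')].
Proof.
move=> Hk H Hr P; have [a [b [Ha Hb E]]] := sorting_affine Hr P.
have [w' [H1 H2 H3 H4]] := normal_position Hk Ha Hb H.
exists w'; split=> //; rewrite H3 -[RHS]E; apply/eq_in_map => s Hs.
rewrite row_nth //; have := affine_bij Ha Hb => /perm_mem/(_ (add4 (mul4 a s) b)).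
by rewrite (map_f (fun s => add4 (mul4 a s) b)) // mem_iota => /esym.
Qed.

Lemma total_class_sums w : total w = sumn (class_sums w).
Proof. by rewrite /total /=; lia. Qed.

Lemma light_row (w : nat -> nat -> nat) j :
  (forall s, s < 4 -> w j s <= 1) -> seg_row w j \in light_rows.
Proof.
move=> H; rewrite /seg_row /=.
have := H 0 isT; have := H 1 isT; have := H 2 isT; have := H 3 isT.
by do 4!case: (w j _) => [|[|//]] _.
Qed.

Definition heavy_row (r : seq nat) : bool := perm_eq r row5 || perm_eq r row6.

Lemma mem_heavy_rows r : (r \in heavy_rows) = heavy_row r.
Proof. by rewrite mem_cat !mem_permutations orbC. Qed.

Lemma perm_light_rows r r' : perm_eq r r' -> r' \in light_rows -> r \in light_rows.
Proof.
move=> P H; have : all (fun r' => all (mem light_rows) (permutations r')) light_rows.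
  by vm_compute.
by move/allP/(_ _ H)/allP; apply; rewrite mem_permutations.
Qed.

Lemma high_line_type w k : capped w -> 21 <= total w -> k < 5 ->
  heavy_row (seg_row w k) ->
  (forall j, j < 5 -> class_sum w j <= 4 \/ heavy_row (seg_row w j)) ->
  high_type (class_sums w).
Proof.
move=> H T Hk hk Hw.
have opt j : j < 5 -> seg_row w j \in heavy_rows ++ light_rows.
  move=> Hj; rewrite mem_cat; case: (Hw j Hj) => [n4|].
    rewrite light_row ?orbT // => s Hs; have := segment_bound H Hj Hs; lia.
  by rewrite mem_heavy_rows => ->.
have optp r r' : perm_eq r r' -> r' \in heavy_rows ++ light_rows ->
    r \in heavy_rows ++ light_rows.
  move=> P; rewrite [r' \in _]mem_cat [r \in _]mem_cat => /orP[|/(perm_light_rows P) ->].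
    by rewrite !mem_heavy_rows /heavy_row !(permPl P) => ->.
  by rewrite orbT.
have [r [Hr Pr]] : exists r, (r = row5 \/ r = row6) /\ perm_eq (seg_row w k) r.
  by case/orP: hk => P; [exists row5 | exists row6]; split; auto.
have [w' [H' P' r0 rj]] := sorted_position Hk H Hr Pr.
have T' : total w' = total w by rewrite !total_class_sums; apply: perm_sumn.
have n0 : class_sum w' 0 = sumn r by rewrite -sumn_row r0.
have o' j : 0 < j < 5 -> seg_row w' j \in heavy_rows ++ light_rows.
  by case/andP=> _ /rj[j' /opt Hj' /optp]; apply.
have b6 : all (fun r => sumn r <= 6) (heavy_rows ++ light_rows) by vm_compute.
have PP : perm_eq (rev (class_sums w')) (class_sums w).
  by apply: perm_trans P'; rewrite perm_rev.
suff : high_type (rev (class_sums w')) by rewrite /high_type !(permPl PP).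
have := @segment_bound w' 0 0 H' isT isT; rewrite -[w' 0 0]/(nth 0 (seg_row w' 0) 0) r0 n0.
case: Hr r0 {n0} => -> r0 /= B.
- apply: (root_search_sound search5) => //; lia.
- apply: (root_search_sound search6) => //; lia.
Qed.

Lemma no_four_fives_and_zero w k : capped w -> total w = 20 -> k < 5 ->
  perm_eq (seg_row w k) row5 ->
  (forall j, j < 5 -> class_sum w j = 0 \/ perm_eq (seg_row w j) row5) -> False.
Proof.
move=> H T Hk hk Hw.
have opt j : j < 5 -> seg_row w j \in nseq 4 0 :: permutations row5.
  move=> Hj; rewrite in_cons mem_permutations; case: (Hw j Hj) => [n0|->]; last by rewrite orbT.
  by apply/orP; left; move: n0; rewrite /class_sum /seg_row /=;
     do 4!case: (w j _) => [|?]; rewrite ?addnS.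
have [w' [H' P' r0 rj]] := sorted_position Hk H (or_introl erefl) hk.
have T' : total w' = 20 by rewrite -T !total_class_sums; apply: perm_sumn.
have : (fun _ : seq nat => false) (rev (class_sums w')); last by [].
apply: (root_search_sound (w := w') search50) => //; last by rewrite T'.
move=> j /andP[_ /rj[j' /opt]]; rewrite in_cons mem_permutations => /orP[/eqP E|E] P;
  rewrite in_cons mem_permutations.
  have : all (pred1 0) (seg_row w' j) by rewrite (perm_all _ P) E.
  by move/all_pred1P=> Ej; rewrite [seg_row w' j]Ej eqxx.
by rewrite (perm_trans P E) orbT.
Qed.

(** * The plane of order four of neighbour classes *)

(* PG(2,4) on Z/21, from the perfect difference set {0, 1, 4, 14, 16}. *)
Definition dset (j : nat) : nat := nth 0 [:: 0; 1; 4; 14; 16] j.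
Definition pt_of (l j : nat) : nat := (l + dset j) %% 21.
Definition ln_of (c i : nat) : nat := (c + (21 - dset i)) %% 21.
Definition pts_of (l : nat) : seq nat := [seq pt_of l j | j <- iota 0 5].
Definition lns_of (c : nat) : seq nat := [seq ln_of c i | i <- iota 0 5].

Lemma pt_of_lt l j : pt_of l j < 21. Proof. exact: ltn_pmod. Qed.
Lemma ln_of_lt c i : ln_of c i < 21. Proof. exact: ltn_pmod. Qed.

Lemma iotaP n m : (m \in iota 0 n) = (m < n). Proof. by rewrite mem_iota. Qed.

Lemma mem_pts_lns c l : c < 21 -> l < 21 -> (c \in pts_of l) = (l \in lns_of c).
Proof.
have : all (fun c => all (fun l => (c \in pts_of l) == (l \in lns_of c))
  (iota 0 21)) (iota 0 21) by vm_compute.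
move=> /allP H Hc Hl; have /allP H' : _ := H c (etrans (iotaP _ _) Hc).
exact/eqP/H'/(etrans (iotaP _ _)).
Qed.

Lemma join_pts c d : c < 21 -> d < 21 -> exists2 i, i < 5 & d \in pts_of (ln_of c i).
Proof.
have : all (fun c => all (fun d => has (fun i => d \in pts_of (ln_of c i)) (iota 0 5))
  (iota 0 21)) (iota 0 21) by vm_compute.
move=> /allP H Hc Hd; have /allP H' : _ := H c (etrans (iotaP _ _) Hc).
by have /hasP[i] := H' d (etrans (iotaP _ _) Hd); rewrite iotaP => ? ?; exists i.
Qed.

Lemma meet_lns l l' : l < 21 -> l' < 21 -> exists2 c, c \in pts_of l & c \in pts_of l'.
Proof.
have : all (fun l => all (fun l' => has (mem (pts_of l')) (pts_of l))
  (iota 0 21)) (iota 0 21) by vm_compute.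
move=> /allP H Hc Hd; have /allP H' : _ := H l (etrans (iotaP _ _) Hc).
by have /hasP[c] := H' l' (etrans (iotaP _ _) Hd); exists c.
Qed.

Lemma uniq_line l l' c d : l < 21 -> l' < 21 -> c \in pts_of l -> d \in pts_of l ->
  c \in pts_of l' -> d \in pts_of l' -> c != d -> l = l'.
Proof.
have : all (fun l => all (fun l' => all (fun c => all (fun d =>
  [&& c \in pts_of l', d \in pts_of l' & c != d] ==> (l == l')) (pts_of l)) (pts_of l))
  (iota 0 21)) (iota 0 21) by vm_compute.
move=> /allP H Hl Hl' cl dl cl' dl' cd.
have /allP H' : _ := H l (etrans (iotaP _ _) Hl).
have /allP/(_ _ cl)/allP/(_ _ dl) := H' l' (etrans (iotaP _ _) Hl').
by rewrite cl' dl' cd => /eqP.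
Qed.

(** For fixed [j] the translations [pt_of] and [ln_of] are mutually inverse, so the double count
    keeps the index [j]. *)
Lemma exchange_flags (F : nat -> nat -> nat -> nat) :
  \sum_(0 <= l < 21) \sum_(0 <= j < 5) F l (pt_of l j) j =
  \sum_(0 <= c < 21) \sum_(0 <= j < 5) F (ln_of c j) c j.
Proof.
rewrite exchange_big_nat [RHS]exchange_big_nat /=; apply: eq_big_nat => j /andP[_ Hj].
have P : perm_eq [seq (l, pt_of l j) | l <- iota 0 21] [seq (ln_of c j, c) | c <- iota 0 21].
  by case: j Hj => [|[|[|[|[|//]]]]] _; vm_compute.
rewrite /index_iota !subn0.
have : \sum_(p <- [seq (l, pt_of l j) | l <- iota 0 21]) F p.1 p.2 j =
       \sum_(p <- [seq (ln_of c j, c) | c <- iota 0 21]) F p.1 p.2 j by apply: perm_big.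
by rewrite !big_map.
Qed.

(** The five lines through [c] cover every other class once and [c] itself five times. *)
Lemma pencil_of_lines (F : nat -> nat) c : c < 21 ->
  \sum_(0 <= i < 5) \sum_(0 <= j < 5) F (pt_of (ln_of c i) j) =
  \sum_(0 <= x < 21) F x + 4 * F c.
Proof.
move=> Hc; have : all (fun c => perm_eq
   [seq pt_of (ln_of c i) j | i <- iota 0 5, j <- iota 0 5] ([:: c, c, c, c & iota 0 21]))
   (iota 0 21) by vm_compute.
move=> /allP/(_ c); rewrite iotaP => /(_ Hc) P.
have : \sum_(x <- [seq pt_of (ln_of c i) j | i <- iota 0 5, j <- iota 0 5]) F x =
       \sum_(x <- [:: c, c, c, c & iota 0 21]) F x by apply: perm_big.
by rewrite big_allpairs_dep 4!big_cons /index_iota !subn0 => ->; lia.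
Qed.

Lemma leq_sum_lt (k : nat) (F G : nat -> nat) : (forall i, i < k -> F i <= G i) ->
  \sum_(0 <= i < k) F i <= \sum_(0 <= i < k) G i.
Proof. by move=> H; rewrite !big_mkord; apply: leq_sum => i _; apply: H. Qed.

(** * Distributions of 84 points over the classes of PG(2,4) *)

Section Weights.
Variable n : nat -> nat.

Definition weights (l : nat) : seq nat := [seq n (pt_of l j) | j <- iota 0 5].
Definition weight (l : nat) : nat := sumn (weights l).
Definition high (l : nat) : bool := 20 < weight l.
Definition typeB (l : nat) : bool := perm_eq (weights l) [:: 5; 5; 5; 3; 3].

Hypothesis sum84 : \sum_(0 <= c < 21) n c = 84.
Hypothesis le_six : forall c, c < 21 -> n c <= 6.
Hypothesis pos_bound : forall c i, c < 21 -> i < 5 -> 4 < n c ->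
  weight (ln_of c i) <= 16 + n c.
Hypothesis high_types : forall l, l < 21 -> high l -> high_type (weights l).

Lemma weightE l : weight l = \sum_(0 <= j < 5) n (pt_of l j).
Proof. by rewrite /weight /weights /index_iota subn0 sumnE big_map. Qed.

Lemma weight5 l : weight l = n (pt_of l 0) + n (pt_of l 1) + n (pt_of l 2) +
  n (pt_of l 3) + n (pt_of l 4).
Proof. by rewrite weightE sum_nat5. Qed.

Lemma count_weights (P : pred nat) l :
  count P (weights l) = \sum_(0 <= j < 5) P (n (pt_of l j)).
Proof. by rewrite /weights count_map /index_iota subn0 -sum1_count big_mkcond. Qed.

Lemma weight_pencil c : c < 21 -> \sum_(0 <= i < 5) weight (ln_of c i) = 84 + 4 * n c.
Proof.
move=> Hc; rewrite -sum84 -pencil_of_lines //.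
by apply: eq_big_nat => i _; rewrite weightE.
Qed.

Lemma weight_on c l : c \in pts_of l -> n c \in weights l.
Proof. by case/mapP=> j Hj ->; apply: map_f. Qed.

Lemma count2 (P : pred nat) c d l : c \in pts_of l -> d \in pts_of l -> c != d ->
  P (n c) -> P (n d) -> 1 < count P (weights l).
Proof.
move=> cl dl cd Pc Pd.
have -> : weights l = [seq n x | x <- pts_of l] by rewrite /pts_of -map_comp.
rewrite count_map -size_filter; apply: (@uniq_leq_size _ [:: c; d]).
  by rewrite /= inE cd.
by move=> x; rewrite !inE mem_filter => /orP[]/eqP ->; rewrite /= ?Pc ?Pd.
Qed.

Lemma on_ln_of c i : c < 21 -> i < 5 -> c \in pts_of (ln_of c i).
Proof. by move=> Hc Hi; rewrite mem_pts_lns ?ln_of_lt // map_f ?iotaP. Qed.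

Lemma ln_ofP c l : c < 21 -> l < 21 -> c \in pts_of l -> exists2 i, i < 5 & l = ln_of c i.
Proof. by move=> Hc Hl; rewrite mem_pts_lns // => /mapP[i]; rewrite iotaP; exists i. Qed.

Lemma on_lt c l : c \in pts_of l -> c < 21.
Proof. by case/mapP=> j _ ->; apply: pt_of_lt. Qed.

Lemma ln_of_inj c i i' : c < 21 -> i < 5 -> i' < 5 -> ln_of c i = ln_of c i' -> i = i'.
Proof.
have : all (fun c => uniq (lns_of c)) (iota 0 21) by vm_compute.
move=> /allP/(_ c); rewrite iotaP => H Hc Hi Hi' E.
have := H Hc; rewrite /lns_of => U; apply/eqP.
rewrite -(nth_uniq 0 _ _ U) ?size_map ?size_iota // !(nth_map 0) ?size_iota //.
by rewrite !nth_iota // !add0n E.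
Qed.

Lemma weight_le22 l : l < 21 -> weight l <= 22.
Proof.
move=> Hl; case: (leqP 21 (weight l)) => [H|]; last by lia.
by case/or4P: (high_types Hl H) => [||| /orP[]] /perm_sumn E; rewrite /weight E.
Qed.

(** On every line through a six, the weight plus the number of sixes is at most 23: by the list of
    high types, or because weight 20 allows only three sixes. Over the five lines the weights add up
    to 108 and the six itself is counted four extra times, so 115 - 108 - 4 = 3 remain. *)
Lemma few_sixes : \sum_(0 <= c < 21) (n c == 6) <= 3.
Proof.
case: (boolP (has (fun c => n c == 6) (iota 0 21))) => [/hasP[c]|/hasPn H]; last first.
  by rewrite big1_seq // => c /andP[_]; rewrite mem_index_iota -iotaP => /H/negbTE->.
rewrite iotaP => Hc /eqP n6.
have := pencil_of_lines (fun x => n x == 6 : nat) Hc; rewrite n6 /= => E.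
have := weight_pencil Hc; rewrite n6 => W.
suff : \sum_(0 <= i < 5) (\sum_(0 <= j < 5) (n (pt_of (ln_of c i) j) == 6)
         + weight (ln_of c i)) <= \sum_(0 <= i < 5) 23.
  by rewrite big_split /= E W sum_nat_const_nat; lia.
apply: leq_sum_lt => i Hi.
rewrite -(count_weights (pred1 6)).
have B := pos_bound Hc Hi; rewrite n6 in B; have {}B := B isT.
have T : high_type (weights (ln_of c i)) \/ weight (ln_of c i) <= 20.
  case: (leqP 21 (weight (ln_of c i))) => H; last by right.
  by left; apply: high_types; rewrite ?ln_of_lt.
case: T => [|H].
  by case/or4P=> [||| /orP[]] P; rewrite /weight (perm_sumn P) (permP P).
have : 6 * count_mem 6 (weights (ln_of c i)) <= weight (ln_of c i).
  rewrite /weight; elim: (weights _) => //= x s IH.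
  by case: (x =P 6) => [->|_] /=; lia.
by move: (count _ _) (weight _) H => q x; lia.
Qed.

(** The five weights through a five are at most 21 and sum to 104, so one is 20 and the others are
    21. *)
Lemma five_low_unique c i i' : c < 21 -> n c = 5 -> i < 5 -> i' < 5 ->
  ~~ high (ln_of c i) -> ~~ high (ln_of c i') -> i = i'.
Proof.
move=> Hc n5 Hi Hi'; rewrite /high -!leqNgt.
have := weight_pencil Hc; rewrite n5 sum_nat5 => W.
have K i0 : i0 < 5 -> weight (ln_of c i0) <= 21.
  by move=> H0; have := pos_bound Hc H0; rewrite n5; apply.
have := K 0 isT; have := K 1 isT; have := K 2 isT; have := K 3 isT; have := K 4 isT.
move: i i' Hi Hi' => [|[|[|[|[|//]]]]] [|[|[|[|[|//]]]]] _ _ //; lia.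
Qed.

Lemma five_low_weight c i : c < 21 -> n c = 5 -> i < 5 -> ~~ high (ln_of c i) ->
  weight (ln_of c i) = 20.
Proof.
move=> Hc n5 Hi; rewrite /high -leqNgt.
have := weight_pencil Hc; rewrite n5 sum_nat5 => W.
have K i0 : i0 < 5 -> weight (ln_of c i0) <= 21.
  by move=> H0; have := pos_bound Hc H0; rewrite n5; apply.
have := K 0 isT; have := K 1 isT; have := K 2 isT; have := K 3 isT; have := K 4 isT.
by move: i Hi => [|[|[|[|[|//]]]]] _; lia.
Qed.

Lemma five_low_exists c : c < 21 -> n c = 5 -> exists2 i, i < 5 & ~~ high (ln_of c i).
Proof.
move=> Hc n5.
have := weight_pencil Hc; rewrite n5 sum_nat5 => W.
case: (boolP (has (fun i => ~~ high (ln_of c i)) (iota 0 5))).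
  by case/hasP=> i; rewrite iotaP; exists i.
move/hasPn=> H.
have := H 0 isT; have := H 1 isT; have := H 2 isT; have := H 3 isT; have := H 4 isT.
rewrite /high; lia.
Qed.

Lemma high_five_type c l : l < 21 -> c \in pts_of l -> n c = 5 -> high l ->
  perm_eq (weights l) [:: 5; 4; 4; 4; 4] \/ typeB l.
Proof.
move=> Hl cl n5 /(high_types Hl)/or4P[A|B|E|/orP[C|D]]; [by left|by right|..];
  have := weight_on cl; by rewrite n5 ?(perm_mem E) ?(perm_mem C) ?(perm_mem D).
Qed.

Lemma typeB_odd l c : typeB l -> c \in pts_of l -> n c = 5 \/ n c = 3.
Proof.
move=> P /weight_on; rewrite (perm_mem P) !inE; lia.
Qed.

Lemma typeA_other m x y : perm_eq (weights m) [:: 5; 4; 4; 4; 4] -> x \in pts_of m ->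
  y \in pts_of m -> x != y -> n x = 5 -> n y = 4.
Proof.
move=> Am xm ym xy nx; have := weight_on ym; rewrite (perm_mem Am) !inE !orbb.
case/orP=> /eqP // ny; have := count2 (P := pred1 5) xm ym xy.
by rewrite (permP Am) /= nx ny eqxx => /(_ isT isT).
Qed.

Lemma uniq_pts l : l < 21 -> uniq (pts_of l).
Proof.
have : all (fun l => uniq (pts_of l)) (iota 0 21) by vm_compute.
by move/allP=> H Hl; apply: H; rewrite iotaP.
Qed.

Lemma weights_pts l : weights l = [seq n x | x <- pts_of l].
Proof. by rewrite /pts_of -map_comp. Qed.

Lemma second_five c l : l < 21 -> typeB l ->
  exists2 c1, c1 \in pts_of l & c != c1 /\ n c1 = 5.
Proof.
move=> Hl B1; case: (boolP (has (fun x => (c != x) && (n x == 5)) (pts_of l))).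
  by case/hasP=> x xl /andP[cx /eqP nx]; exists x.
move/hasPn=> H; have : count_mem 5 (weights l) = 3 by rewrite (permP B1).
rewrite weights_pts count_map => C.
have : count (preim n (pred1 5)) (pts_of l) <= count_mem c (pts_of l).
  rewrite (_ : count _ _ = count (predI (preim n (pred1 5)) (pred1 c)) (pts_of l)).
    by apply: sub_count => x /andP[].
  apply: eq_in_count => x /H /=; rewrite negb_and negbK eq_sym.
  by case/orP=> [->|/negbTE->]; rewrite ?andbT.
by rewrite C count_uniq_mem ?uniq_pts //; case: (_ \in _).
Qed.

(* A line through a further five of a line of type B meets the type A line in a
   four and the second type B line in an odd class. *)
Lemma no_mixed_five c l1 l2 k : c < 21 -> n c = 5 -> l1 < 21 -> l2 < 21 -> k < 21 ->
  c \in pts_of l1 -> c \in pts_of l2 -> c \in pts_of k -> l1 != l2 ->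
  typeB l1 -> typeB l2 -> perm_eq (weights k) [:: 5; 4; 4; 4; 4] -> False.
Proof.
move=> Hc n5 Hl1 Hl2 Hk cl1 cl2 ck l12 B1 B2 A.
have [c1 c1l1 [cc1 n1]] := second_five c Hl1 B1.
have H1 := on_lt c1l1.
have [i1 Hi1 E1] := ln_ofP H1 Hl1 c1l1.
(* At most one line through [c1] is low, so of two lines other than [l1] one is high. *)
have [i [Hi ii1 hi]] : exists i, [/\ i < 5, i != i1 & high (ln_of c1 i)].
  pose a := if i1 == 0 then 1 else 0.
  pose b := if (i1 == 1) || (i1 == 0) then 2 else 1.
  have [Ha Hb ai bi ab] : [/\ a < 5, b < 5, a != i1, b != i1 & a != b].
    by rewrite /a /b; move: (i1) Hi1 => [|[|[|[|[|//]]]]].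
  case: (boolP (high (ln_of c1 a))) => [h|h]; first by exists a.
  case: (boolP (high (ln_of c1 b))) => [h'|h']; first by exists b.
  by move: ab; rewrite (five_low_unique H1 n1 Ha Hb h h') eqxx.
set m := ln_of c1 i in hi.
have Hm : m < 21 := ln_of_lt _ _.
have c1m : c1 \in pts_of m := on_ln_of H1 Hi.
have ml1 : m <> l1 by rewrite E1 => /ln_of_inj E; move: ii1; rewrite E ?eqxx.
have cm : c \notin pts_of m.
  by apply/negP => cm; apply: ml1; apply: (uniq_line Hm Hl1 cm c1m cl1 c1l1 cc1).
have [x xm xk] := meet_lns Hm Hk.
have cx : c != x by apply: contraNneq cm => ->.
have nx := typeA_other A ck xk cx n5.
have [Am|Bm] := high_five_type Hm c1m n1 hi; last first.
  by case: (typeB_odd Bm xm); rewrite nx.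
have [y ym yl2] := meet_lns Hm Hl2.
have c1y : c1 != y.
  apply: contraNneq l12 => E; rewrite -E in yl2.
  by apply/eqP; apply: (uniq_line Hl1 Hl2 cl1 c1l1 cl2 yl2 cc1).
by case: (typeB_odd B2 yl2); rewrite (typeA_other Am c1m ym c1y n1).
Qed.

Hypothesis no_four_fives : forall l, l < 21 -> weight l = 20 ->
  (forall j, j < 5 -> n (pt_of l j) = 0 \/ n (pt_of l j) = 5) -> False.

Definition odd_class (c : nat) : bool := (n c == 5) || (n c == 3).

Lemma line_count_le (P : pred nat) l : l < 21 ->
  count P (weights l) <= \sum_(0 <= x < 21) P (n x).
Proof.
move=> Hl; rewrite weights_pts count_map -size_filter.
have -> : \sum_(0 <= x < 21) P (n x) = size [seq x <- iota 0 21 | P (n x)].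
  by rewrite size_filter -sum1_count [RHS]big_mkcond /index_iota subn0.
apply: uniq_leq_size; first by rewrite filter_uniq ?uniq_pts.
by move=> x; rewrite !mem_filter iotaP => /andP[/= -> /on_lt].
Qed.

Section Pure.
Variable c : nat.
Hypotheses (Hc : c < 21) (n5 : n c = 5).
Hypothesis pure : forall i, i < 5 -> high (ln_of c i) -> typeB (ln_of c i).

(** All classes with neither 5 nor 3 points lie on the one low line through [c]. A high line through
    another five [c1] of a type B line meets a second type B line in an odd class, so it has type B
    too. Hence these classes also lie on the low line through [c1], and the two low lines differ. *)
Lemma pure_one_even x y : x < 21 -> y < 21 -> ~~ odd_class x -> ~~ odd_class y -> x = y.
Proof.
have [i0 Hi0 low0] := five_low_exists Hc n5.
have bad_on z : z < 21 -> ~~ odd_class z -> z \in pts_of (ln_of c i0).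
  move=> Hz bz; have [i Hi zi] := join_pts Hc Hz.
  case: (boolP (high (ln_of c i))) => [/(pure Hi) B|low].
    by case/negP: bz; rewrite /odd_class; case: (typeB_odd B zi) => ->.
  by rewrite -(five_low_unique Hc n5 Hi Hi0 low low0).
have [i1 [i2 [Hi1 Hi2 i12 i10 i20]]] :
    exists i1 i2, [/\ i1 < 5, i2 < 5, i1 != i2, i1 != i0 & i2 != i0].
  move: (i0) Hi0 => [|[|[|[|[|//]]]]] _;
  by [exists 1, 2|exists 0, 2|exists 0, 1|exists 0, 1|exists 0, 1].
have hi i : i < 5 -> i != i0 -> high (ln_of c i).
  move=> Hi ii0; apply/negP => /negP low; move: ii0.
  by rewrite (five_low_unique Hc n5 Hi Hi0 low low0) eqxx.
have B1 := pure Hi1 (hi _ Hi1 i10); have B2 := pure Hi2 (hi _ Hi2 i20).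
have [c1 c1l1 [cc1 n1]] := second_five c (ln_of_lt _ _) B1.
have H1 := on_lt c1l1.
have low z : z < 21 -> ~~ odd_class z -> exists i, [/\ i < 5, z \in pts_of (ln_of c1 i)
    & ~~ high (ln_of c1 i)].
  move=> Hz bz; have [i Hi zi] := join_pts H1 Hz; exists i; split=> //.
  have c1i := on_ln_of H1 Hi.
  apply/negP => h; case: (high_five_type (ln_of_lt _ _) c1i n1 h) => [A|B]; last first.
    by case/negP: bz; rewrite /odd_class; case: (typeB_odd B zi) => ->.
  have [t tm tl2] := meet_lns (ln_of_lt c1 i) (ln_of_lt c i2).
  have c1t : c1 != t.
    apply: contraNneq i12 => E; rewrite -E in tl2; apply/eqP.
    apply: (@ln_of_inj c) => //; apply: (uniq_line _ _ _ c1l1 _ tl2 cc1);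
    by rewrite ?ln_of_lt ?on_ln_of.
  by case: (typeB_odd B2 tl2); rewrite (typeA_other A c1i tm c1t n1).
move=> Hx Hy bx by_; apply/eqP/negPn/negP => xy.
have [i [Hi xi li]] := low _ Hx bx; have [i' [Hi' yi li']] := low _ Hy by_.
have E := five_low_unique H1 n1 Hi Hi' li li'; rewrite -{}E {i' Hi' li'} in yi.
have E : ln_of c1 i = ln_of c i0.
  by apply: (uniq_line _ _ xi yi _ _ xy); rewrite ?ln_of_lt ?bad_on.
have c1l0 : c1 \in pts_of (ln_of c i0) by rewrite -E on_ln_of.
case/negP: i10; apply/eqP; apply: (@ln_of_inj c) => //.
by apply: (uniq_line _ _ _ c1l1 _ c1l0 cc1); rewrite ?ln_of_lt ?on_ln_of.
Qed.

(** By parity there is exactly one class [e0] with neither 5 nor 3 points. Counting fives on high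
    lines leaves 0 or 6 points for it; the weights through [e0] exclude 6, and [no_four_fives]
    excludes 0. *)
Lemma pure_contradiction : False.
Proof.
have [e0 He0 be0] : exists2 e0, e0 < 21 & ~~ odd_class e0.
  case: (boolP (has (fun x => ~~ odd_class x) (iota 0 21))).
    by case/hasP=> x; rewrite iotaP; exists x.
  move/hasPn=> H.
  have : odd (\sum_(0 <= x < 21) n x) = odd (\sum_(0 <= x < 21) 1).
    rewrite !(big_morph odd oddD (erefl : odd 0 = false)).
    apply: eq_big_nat => x; rewrite -mem_index_iota => /H.
    by rewrite negbK /odd_class => /orP[]/eqP->.
  by rewrite sum84 sum_nat_const_nat.
have odd_x x : x < 21 -> x != e0 -> odd_class x.
  by move=> Hx xe; apply/negPn/negP => /pure_one_even/(_ be0) E; rewrite E ?eqxx in xe.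
pose p5 := \sum_(0 <= x < 21) (n x == 5).
(* The other 20 classes are fives or threes, so 84 is [5 * p5 + 3 * (20 - p5) + n e0]. *)
have P : 2 * p5 + n e0 = 24.
  have : \sum_(0 <= x < 21) (n x + (if x == e0 then 3 else 0)) =
         \sum_(0 <= x < 21) ((if x == e0 then n e0 else 0) + (2 * (n x == 5) + 3)).
    apply: eq_big_nat => x /andP[_ Hx]; case: eqP => [->|/eqP xe].
      by move: be0; rewrite /odd_class; case: eqP => //= _ _; lia.
    by have := odd_x x Hx xe; rewrite /odd_class; case: eqP => [->|_ /eqP ->].
  rewrite big_split /= sum84 -big_mkcond /= big_nat1_eq He0.
  rewrite [in RHS]big_split /= -big_mkcond /= big_nat1_eq He0 [in RHS]big_split /=.
  by rewrite sum_nat_const_nat -big_distrr /= -/p5; lia.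
have bad1 : \sum_(0 <= x < 21) ((n x != 5) && (n x != 3)) <= 1.
  apply: (@leq_trans (\sum_(0 <= x < 21) (x == e0))).
    apply: leq_sum_lt => x Hx; case: (eqVneq x e0) => [_|/(odd_x x Hx)].
      by case: (_ && _).
    by rewrite /odd_class -negb_or => ->.
  by rewrite (eq_bigr (fun x => if x == e0 then 1 else 0)) -?big_mkcond /= ?big_nat1_eq ?He0.
(* Every other high type contains at least two classes that are neither five nor three. *)
have allB l : l < 21 -> high l -> typeB l.
  move=> Hl /(high_types Hl)/or4P T.
  have := leq_trans (line_count_le (fun v => (v != 5) && (v != 3)) Hl) bad1.
  by case: T => [|//||/orP[]] Q; rewrite (permP Q).
(* Each high line has three fives, and each five lies on four high lines. *)
have E34 : 3 * \sum_(0 <= l < 21) high l = 4 * p5.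
  have := exchange_flags (fun l x _ => high l * (n x == 5)).
  rewrite (eq_big_nat _ _ (F2 := fun l => 3 * high l)); last first.
    move=> l /andP[_ Hl]; rewrite -big_distrr -(count_weights (pred1 5)).
    by case: (boolP (high l)) => // /(allB l Hl) B; rewrite (permP B).
  rewrite -big_distrr /= => ->; rewrite /p5 big_distrr /=.
  apply: eq_big_nat => x /andP[_ Hx]; rewrite -big_distrl /= mulnC.
  case: eqP => [x5|_]; last by rewrite mul0n muln0.
  rewrite mul1n muln1 sum_nat5.
  have [i0 Hi0 low0] := five_low_exists Hx x5.
  have hi i : i < 5 -> high (ln_of x i) = (i != i0).
    move=> Hi; case: (eqVneq i i0) => [->|/eqP ii0]; first exact/negbTE.
    by apply/negPn/negP => low; apply: ii0; apply: (five_low_unique Hx x5).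
  by rewrite !hi //; move: (i0) Hi0 => [|[|[|[|[|//]]]]].
(* No type B line contains a six, so the lines through [e0] would weigh at most 100 together instead
   of 108. *)
have e6 : n e0 != 6.
  apply/eqP => e6; have := weight_pencil He0; rewrite e6 sum_nat5.
  suff K i : i < 5 -> weight (ln_of e0 i) <= 20.
    have := K 0 isT; have := K 1 isT; have := K 2 isT; have := K 3 isT.
    by have := K 4 isT; lia.
  move=> Hi; rewrite leqNgt; apply/negP => /(allB _ (ln_of_lt _ _)) B.
  by case: (typeB_odd B (on_ln_of He0 Hi)); rewrite e6.
have e00 : n e0 = 0 by have := le_six He0; lia.
have [i0 Hi0 low0] := five_low_exists Hc n5.
have W := five_low_weight Hc n5 Hi0 low0.
have [j0 Hj0 Ej0] : exists2 j, j < 5 & pt_of (ln_of c i0) j = e0.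
  have [i Hi ei] := join_pts Hc He0.
  case: (boolP (high (ln_of c i))) => [/(pure Hi) B|low].
    by case: (typeB_odd B ei); rewrite e00.
  by move: ei; rewrite (five_low_unique Hc n5 Hi Hi0 low low0) => /mapP[j];
    rewrite iotaP => Hj ->; exists j.
have V j : j < 5 -> n (pt_of (ln_of c i0) j) <= 5.
  move=> Hj; case: (eqVneq (pt_of (ln_of c i0) j) e0) => [->|/(odd_x _ (pt_of_lt _ _))].
    by rewrite e00.
  by case/orP=> /eqP->.
apply: (no_four_fives (ln_of_lt c i0) W) => j Hj; move: W; rewrite weight5.
have := V 0 isT; have := V 1 isT; have := V 2 isT; have := V 3 isT; have := V 4 isT.
have : n (pt_of (ln_of c i0) j0) = 0 by rewrite Ej0.
by move: j0 j Hj0 Hj {Ej0} => [|[|[|[|[|//]]]]] [|[|[|[|[|//]]]]] _ _; lia.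
Qed.

End Pure.

(* Each line class of weight above 20 distributes 6 units evenly over its classes
   with more than four points. *)
Definition share (l : nat) : nat :=
  if high l then
    if typeB l then 2 else if count_mem 6 (weights l) == 2 then 3 else 6
  else 0.

Lemma share_line l : l < 21 ->
  share l * count (fun v => 4 < v) (weights l) = 6 * high l.
Proof.
move=> Hl; rewrite /share; case: ifP => // /(high_types Hl)/or4P T.
by case: T => [||| /orP[]] P; rewrite /typeB (permPl P) !(permP P).
Qed.

(** A five lies on four high lines. Two of type B would make all four of type B by [no_mixed_five],
    which [pure_contradiction] excludes, so the shares are at least 6 + 6 + 6 + 2. *)
Lemma share_five c : c < 21 -> n c = 5 -> 20 <= \sum_(0 <= i < 5) share (ln_of c i).
Proof.
move=> Hc n5; pose B i := high (ln_of c i) && typeB (ln_of c i).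
have A i : i < 5 -> high (ln_of c i) -> ~~ B i ->
    perm_eq (weights (ln_of c i)) [:: 5; 4; 4; 4; 4].
  move=> Hi h; rewrite /B h /=.
  by case: (high_five_type (ln_of_lt _ _) (on_ln_of Hc Hi) n5 h) => // ->.
have one i i' : i < 5 -> i' < 5 -> i != i' -> B i -> B i' -> False.
  move=> Hi Hi' ii' /andP[hi Bi] /andP[hi' Bi'].
  apply: (pure_contradiction Hc n5) => k Hk hk; apply/negPn/negP => nB.
  apply: (no_mixed_five Hc n5 _ _ _ _ _ _ _ Bi Bi'
    (A k Hk hk _)); rewrite ?ln_of_lt ?on_ln_of //; last by rewrite /B hk.
  by apply: contraNneq ii' => /ln_of_inj ->.
have [i0 Hi0 low0] := five_low_exists Hc n5.
have S i : i < 5 -> share (ln_of c i) = if i == i0 then 0 else if B i then 2 else 6.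
  move=> Hi; case: (eqVneq i i0) => [->|/eqP ii0]; first by rewrite /share (negbTE low0).
  have h : high (ln_of c i).
    by apply/negPn/negP => low; apply: ii0; apply: (five_low_unique Hc n5).
  case: ifP => [/andP[_ b]|/negbT nB]; first by rewrite /share h b.
  by rewrite /share h /typeB (permPl (A i Hi h nB)) (permP (A i Hi h nB)).
have two i i' : i < 5 -> i' < 5 -> i != i' -> B i + B i' <= 1.
  move=> Hi Hi' ii'; case: (boolP (B i)) => b; case: (boolP (B i')) => b' //.
  by case: (one _ _ Hi Hi' ii' b b').
rewrite sum_nat5 !S //.
have := two 0 1 isT isT isT; have := two 0 2 isT isT isT; have := two 0 3 isT isT isT.
have := two 0 4 isT isT isT; have := two 1 2 isT isT isT; have := two 1 3 isT isT isT.
have := two 1 4 isT isT isT; have := two 2 3 isT isT isT; have := two 2 4 isT isT isT.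
have := two 3 4 isT isT isT.
by move: (i0) Hi0 => [|[|[|[|[|//]]]]] _ /=;
  case: (B 0); case: (B 1); case: (B 2); case: (B 3); case: (B 4).
Qed.

(** Every line through a six satisfies [3 * weight <= share + 60], and the five weights sum to
    108. *)
Lemma share_six c : c < 21 -> n c = 6 -> 24 <= \sum_(0 <= i < 5) share (ln_of c i).
Proof.
move=> Hc n6; have := weight_pencil Hc; rewrite n6 => W.
suff : \sum_(0 <= i < 5) 3 * weight (ln_of c i) <=
       \sum_(0 <= i < 5) (share (ln_of c i) + 60).
  by rewrite -big_distrr /= W big_split sum_nat_const_nat /=; lia.
apply: leq_sum_lt => i Hi; rewrite /share /high.
case: ifP => [h|/negbT]; last by rewrite -leqNgt; lia.
have w6 := weight_on (on_ln_of Hc Hi); rewrite n6 in w6.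
have /or4P T := high_types (ln_of_lt c i) h.
by case: T => [||| /orP[]] P; move: w6; rewrite (perm_mem P) // /typeB (permPl P)
  /weight (perm_sumn P) (permP P).
Qed.

Hypothesis four_count : 12 * \sum_(0 <= c < 21) (n c == 4) <=
  \sum_(0 <= l < 21) (12 * ~~ high l + 4 * \sum_(0 <= j < 5) (n (pt_of l j) <= 2)).

Lemma all_at_most_four c : c < 21 -> n c <= 4.
Proof.
have E1 : \sum_(0 <= l < 21) 6 * high l =
    \sum_(0 <= c < 21) (4 < n c) * \sum_(0 <= i < 5) share (ln_of c i).
  have := exchange_flags (fun l x _ => (4 < n x) * share l).
  rewrite (eq_big_nat _ _ (F2 := fun l => 6 * high l)); last first.
    by move=> l /andP[_ Hl]; rewrite -share_line // count_weights mulnC big_distrl.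
  by move=> ->; apply: eq_big_nat => x _; rewrite big_distrr.
have E2 : \sum_(0 <= l < 21) \sum_(0 <= j < 5) (n (pt_of l j) <= 2) =
    \sum_(0 <= c < 21) 5 * (n c <= 2).
  have -> := exchange_flags (fun l x _ => n x <= 2 : nat).
  by apply: eq_big_nat => x _; rewrite sum_nat_const_nat.
pose p4 := \sum_(0 <= c < 21) (n c == 4); pose p2 := \sum_(0 <= c < 21) (n c <= 2).
pose p5 := \sum_(0 <= c < 21) (n c == 5); pose p6 := \sum_(0 <= c < 21) (n c == 6).
pose m := \sum_(0 <= l < 21) high l.
have Hm : \sum_(0 <= l < 21) ~~ high l + m = 21.
  rewrite -big_split /= (eq_big_nat _ _ (F2 := fun=> 1)) ?sum_nat_const_nat //.
  by move=> l _; case: (high l).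
have K1 : 12 * p4 + 12 * m <= 252 + 20 * p2.
  move: four_count; rewrite big_split /= -2!big_distrr /= E2 -big_distrr /= -/p4 -/p2.
  by move: Hm; lia.
have K2 : 20 * p5 + 24 * p6 <= 6 * m.
  rewrite /m /p5 /p6 !big_distrr /= E1 -big_split; apply: leq_sum_lt => x Hx.
  case: (eqVneq (n x) 5) => [e|_]; first by rewrite e mul1n share_five.
  by case: (eqVneq (n x) 6) => [e|_] //; rewrite e mul1n share_six.
(* Sum of a pointwise inequality with equality at 2, 4, 5 and 6 points. *)
have K3 : 126 + 10 * p2 <= 6 * p4 + 14 * p5 + 22 * p6.
  have : \sum_(0 <= x < 21) (6 + 10 * (n x <= 2) + 8 * n x) <=
    \sum_(0 <= x < 21) (32 + 6 * (n x == 4) + 14 * (n x == 5) + 22 * (n x == 6)).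
    by apply: leq_sum_lt => x /le_six; move: (n x) => [|[|[|[|[|[|[|//]]]]]]].
  have d (k : nat) (F : nat -> nat) : \sum_(0 <= x < 21) k * F x =
    k * \sum_(0 <= x < 21) F x by rewrite big_distrr.
  have l2 k F G : \sum_(0 <= x < 21) (k + F x + G x) =
      21 * k + \sum_(0 <= x < 21) F x + \sum_(0 <= x < 21) G x.
    by rewrite 2!big_split /= sum_nat_const_nat.
  have l3 k F G H : \sum_(0 <= x < 21) (k + F x + G x + H x) = 21 * k +
      \sum_(0 <= x < 21) F x + \sum_(0 <= x < 21) G x + \sum_(0 <= x < 21) H x.
    by rewrite 3!big_split /= sum_nat_const_nat.
  rewrite (l2 6 (fun x => 10 * (n x <= 2)) (fun x => 8 * n x)).
  rewrite (l3 32 (fun x => 6 * (n x == 4)) (fun x => 14 * (n x == 5))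
    (fun x => 22 * (n x == 6))).
  rewrite (d 10 (fun x => n x <= 2 : nat)) (d 8 n) (d 6 (fun x => n x == 4 : nat)).
  rewrite (d 14 (fun x => n x == 5 : nat)) (d 22 (fun x => n x == 6 : nat)).
  by rewrite -/p2 -/p4 -/p5 -/p6 sum84; lia.
(* [K1] together with twice [K2] and twice [K3] gives [12 * p5 + 4 * p6 <= 0]. *)
have : p5 + p6 = 0 by lia.
move/eqP; rewrite addn_eq0 !sum_nat_seq_eq0 => /andP[/allP H5 /allP H6] Hc.
have := H5 c; have := H6 c; rewrite !mem_index_iota Hc => /(_ isT) + /(_ isT).
by have := le_six Hc; lia.
Qed.

End Weights.

(** * Arcs of size 84 *)

Lemma ln_of_pt_of l j : l < 21 -> j < 5 -> ln_of (pt_of l j) j = l.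
Proof.
have : all (fun l => all (fun j => ln_of (pt_of l j) j == l) (iota 0 5)) (iota 0 21).
  by vm_compute.
move=> /allP H Hl Hj; have /allP H' : _ := H l (etrans (iotaP _ _) Hl).
exact/eqP/H'/(etrans (iotaP _ _)).
Qed.

Lemma pt_of_ln_of c i : c < 21 -> i < 5 -> pt_of (ln_of c i) i = c.
Proof.
have : all (fun c => all (fun i => pt_of (ln_of c i) i == c) (iota 0 5)) (iota 0 21).
  by vm_compute.
move=> /allP H Hl Hj; have /allP H' : _ := H c (etrans (iotaP _ _) Hl).
exact/eqP/H'/(etrans (iotaP _ _)).
Qed.

Lemma sum_nat4 (F : nat -> nat) : \sum_(0 <= s < 4) F s = F 0 + F 1 + F 2 + F 3.
Proof. by rewrite /index_iota subn0 /= !big_cons big_nil; lia. Qed.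

Lemma sum_eq_lt k a : \sum_(0 <= s < k) (a == s) = (a < k).
Proof.
rewrite (eq_bigr (fun s => if s == a then 1 else 0)); last first.
  by move=> s _; rewrite eq_sym; case: eqP.
by rewrite -big_mkcond big_nat1_eq; case: (a < k).
Qed.

Lemma sum_le1 k (P : pred nat) :
  (forall b b', b < k -> b' < k -> P b -> P b' -> b = b') ->
  \sum_(0 <= b < k) P b <= 1.
Proof.
move=> H; case: (boolP (has P (iota 0 k))) => [/hasP[b]|/hasPn H'].
  rewrite iotaP => Hb Pb; apply: (@leq_trans (\sum_(0 <= x < k) (b == x))).
    apply: leq_sum_lt => x Hx; case: (boolP (P x)) => // Px.
    by rewrite (H _ _ Hb Hx Pb Px) eqxx.
  by rewrite sum_eq_lt; case: (_ < _).
rewrite big1_seq // => x /andP[_]; rewrite mem_index_iota => Hx.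
by rewrite (negbTE (H' x _)) ?iotaP.
Qed.

Lemma profile5 a b c d : a <= 2 -> b <= 2 -> c <= 2 -> d <= 2 -> a + b + c + d = 5 ->
  a ^ 2 + b ^ 2 + c ^ 2 + d ^ 2 <= 9 /\
  (a ^ 2 + b ^ 2 + c ^ 2 + d ^ 2 = 9 -> perm_eq [:: a; b; c; d] row5).
Proof.
by case: a => [|[|[|//]]] _; case: b => [|[|[|//]]] _; case: c => [|[|[|//]]] _;
   case: d => [|[|[|//]]] _.
Qed.

Lemma profile6 a b c d : a <= 2 -> b <= 2 -> c <= 2 -> d <= 2 -> a + b + c + d = 6 ->
  a ^ 2 + b ^ 2 + c ^ 2 + d ^ 2 <= 12 /\
  (a ^ 2 + b ^ 2 + c ^ 2 + d ^ 2 = 12 -> perm_eq [:: a; b; c; d] row6).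
Proof.
by case: a => [|[|[|//]]] _; case: b => [|[|[|//]]] _; case: c => [|[|[|//]]] _;
   case: d => [|[|[|//]]] _.
Qed.

(* With three points on one segment, every other direction is met in at least
   three segments. *)
Lemma profile4_spread a b c d : a + b + c + d = 4 ->
  3 <= (0 < a) + (0 < b) + (0 < c) + (0 < d) ->
  a ^ 2 + b ^ 2 + c ^ 2 + d ^ 2 = 4 \/
  a ^ 2 + b ^ 2 + c ^ 2 + d ^ 2 = 6 /\ [|| a == 2, b == 2, c == 2 | d == 2].
Proof.
move=> E H; have [a2 b2 c2 d2] : [/\ a <= 2, b <= 2, c <= 2 & d <= 2] by split; lia.
by case: a a2 E H => [|[|[|//]]] _; case: b b2 => [|[|[|//]]] _;
   case: c c2 => [|[|[|//]]] _; case: d d2 => [|[|[|//]]] _; auto.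
Qed.

Lemma sqr_sum1 a b c : a + b + c = 1 -> a ^ 2 + b ^ 2 + c ^ 2 = 1.
Proof. by case: a => [|[|?]]; case: b => [|[|?]]; case: c => [|[|?]] //; lia. Qed.

Lemma sqr_le2 a b c d : a <= 2 -> b <= 2 -> c <= 2 -> d <= 2 -> a + b + c + d = 4 ->
  a ^ 2 + b ^ 2 + c ^ 2 + d ^ 2 <= 8.
Proof.
by case: a => [|[|[|//]]] _; case: b => [|[|[|//]]] _; case: c => [|[|[|//]]] _;
   case: d => [|[|[|//]]] _.
Qed.

Lemma sqr_le1 a b c d : a <= 1 -> b <= 1 -> c <= 1 -> d <= 1 ->
  a ^ 2 + b ^ 2 + c ^ 2 + d ^ 2 <= 4.
Proof.
by case: a => [|[|//]] _; case: b => [|[|//]] _; case: c => [|[|//]] _;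
   case: d => [|[|//]] _.
Qed.

Section Arc.
(** [K c b] tells whether point [b] of class [c] belongs to the arc, and [S l j b] is the label of
    the segment through point [b] of class [pt_of l j] in the direction of line class [l].
    [S_affine] is the axiom of AG(2,4) that two distinct points share a segment in exactly one of
    the five directions. *)
Variables (K : nat -> nat -> bool) (S : nat -> nat -> nat -> nat).
Hypothesis S_lt : forall l j b, l < 21 -> j < 5 -> b < 16 -> S l j b < 4.
Hypothesis S_affine : forall c b b', c < 21 -> b < 16 -> b' < 16 ->
  \sum_(0 <= i < 5) (S (ln_of c i) i b == S (ln_of c i) i b') = 1 + 4 * (b == b').

Definition seg_count (l j s : nat) : nat :=
  \sum_(0 <= b < 16) (K (pt_of l j) b && (S l j b == s)).
Definition class_count (c : nat) : nat := \sum_(0 <= b < 16) K c b.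

Hypothesis size84 : \sum_(0 <= c < 21) class_count c = 84.
Hypothesis cap : forall l, l < 21 -> capped (seg_count l).

Local Notation n := class_count.

Lemma class_sum_count l j : l < 21 -> j < 5 -> class_sum (seg_count l) j = n (pt_of l j).
Proof.
move=> Hl Hj; rewrite /class_sum -(sum_nat4 (seg_count l j)) exchange_big_nat /=.
apply: eq_big_nat => b /andP[_ Hb].
rewrite (eq_bigr (fun s => K (pt_of l j) b * (S l j b == s))); last first.
  by move=> s _; rewrite mulnb.
by rewrite -big_distrr /= sum_eq_lt S_lt // muln1.
Qed.

Lemma class_sums_count l : l < 21 -> class_sums (seg_count l) = weights n l.
Proof.
by move=> Hl; apply/eq_in_map => j; rewrite iotaP => Hj; apply: class_sum_count.
Qed.

Lemma total_count l : l < 21 -> total (seg_count l) = weight n l.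
Proof. by move=> Hl; rewrite total_class_sums class_sums_count. Qed.

Definition dir_count (c i s : nat) : nat := seg_count (ln_of c i) i s.
Definition dir_sqr (c i : nat) : nat := class_sqr (seg_count (ln_of c i)) i.

Lemma dir_countE c i s : c < 21 -> i < 5 ->
  dir_count c i s = \sum_(0 <= b < 16) (K c b && (S (ln_of c i) i b == s)).
Proof. by move=> Hc Hi; rewrite /dir_count /seg_count pt_of_ln_of. Qed.

Lemma dir_count_sum c i : c < 21 -> i < 5 ->
  dir_count c i 0 + dir_count c i 1 + dir_count c i 2 + dir_count c i 3 = n c.
Proof.
by move=> Hc Hi; have := class_sum_count (ln_of_lt c i) Hi; rewrite pt_of_ln_of.
Qed.

Lemma dir_sqr_pairs c i : c < 21 -> i < 5 -> dir_sqr c i =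
  \sum_(0 <= b < 16) \sum_(0 <= b' < 16)
     (K c b && K c b') * (S (ln_of c i) i b == S (ln_of c i) i b').
Proof.
move=> Hc Hi; rewrite /dir_sqr /class_sqr.
rewrite -(sum_nat4 (fun s => seg_count (ln_of c i) i s ^ 2)).
rewrite (eq_bigr (fun s => \sum_(0 <= b < 16) \sum_(0 <= b' < 16)
  (K c b && K c b') * ((S (ln_of c i) i b == s) * (S (ln_of c i) i b' == s)))); last first.
  move=> s _; rewrite -/(dir_count c i s) dir_countE // expnS expn1 big_distrlr /=.
  apply: eq_bigr => b _; apply: eq_bigr => b' _.
  by rewrite -!mulnb; lia.
rewrite exchange_big_nat /=; apply: eq_big_nat => b /andP[_ Hb].
rewrite exchange_big_nat /=; apply: eq_big_nat => b' _.
rewrite -big_distrr /=; congr (_ * _).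
rewrite (eq_bigr (fun s => (S (ln_of c i) i b == S (ln_of c i) i b') *
   (S (ln_of c i) i b == s))); last first.
  move=> s _; case: (eqVneq (S (ln_of c i) i b) s) => [->|_] /=.
    by rewrite mul1n muln1 eq_sym.
  by rewrite muln0.
by rewrite -big_distrr /= sum_eq_lt S_lt ?ln_of_lt // muln1.
Qed.

(** The squares count ordered pairs on a common segment: distinct points in one direction, equal
    points in all five, in total [n (n - 1) + 5 n]. *)
Lemma class_second_moment c : c < 21 ->
  \sum_(0 <= i < 5) dir_sqr c i = n c ^ 2 + 4 * n c.
Proof.
move=> Hc; rewrite (eq_big_nat _ _ (F2 := fun i => \sum_(0 <= b < 16) \sum_(0 <= b' < 16)
  (K c b && K c b') * (S (ln_of c i) i b == S (ln_of c i) i b'))); last first.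
  by move=> i /andP[_ Hi]; apply: dir_sqr_pairs.
rewrite exchange_big_nat /= expnS expn1 {1}/class_count big_distrl /=.
rewrite {2}/class_count big_distrr /= -big_split /=.
apply: eq_big_nat => b /andP[_ Hb]; rewrite exchange_big_nat /=.
rewrite (eq_big_nat _ _ (F2 := fun b' => K c b * K c b' + 4 * (K c b * (b == b')))).
  rewrite big_split /= -!big_distrr /=; congr (_ + _).
  by rewrite sum_eq_lt Hb muln1.
move=> b' /andP[_ Hb']; rewrite -big_distrr /= S_affine // -mulnb.
by case: (eqVneq b b') => [<-|_]; case: (K c b); case: (K c _).
Qed.

(** Distinct points on a common segment lie on different segments in every other direction. *)
Lemma dir_support c i i' s : c < 21 -> i < 5 -> i' < 5 -> i != i' ->
  dir_count c i s <= \sum_(0 <= t < 4) (0 < dir_count c i' t).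
Proof.
move=> Hc Hi Hi' ii'.
have -> : dir_count c i s = \sum_(0 <= t < 4) \sum_(0 <= b < 16)
    [&& K c b, S (ln_of c i) i b == s & S (ln_of c i') i' b == t].
  rewrite exchange_big_nat /= dir_countE //; apply: eq_big_nat => b /andP[_ Hb].
  rewrite (eq_bigr (fun t => (K c b && (S (ln_of c i) i b == s)) *
     (S (ln_of c i') i' b == t))); last by move=> t _; rewrite mulnb andbA.
  by rewrite -big_distrr /= sum_eq_lt S_lt ?ln_of_lt // muln1.
apply: leq_sum_lt => t Ht; rewrite dir_countE //.
case: (posnP (\sum_(0 <= b < 16) (K c b && (S (ln_of c i') i' b == t)))) => [E|_].
  rewrite -[leqRHS]/0 -[leqRHS]E; apply: leq_sum_lt => b Hb.
  by case: (K c b) => //=; case: (_ == s).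
apply: sum_le1 => b b' Hb Hb' /and3P[_ /eqP e1 /eqP e2] /and3P[_ /eqP e3 /eqP e4].
apply/eqP/negPn/negP => bb'.
have := S_affine Hc Hb Hb'; rewrite (negbTE bb') /= muln0 addn0.
have : forall k, k < 5 -> (k == i) + (k == i') <= (S (ln_of c k) k b == S (ln_of c k) k b').
  move=> k Hk; case: (eqVneq k i) ii' => [->|_] ii'; first by rewrite (negbTE ii') e1 e3 eqxx.
  by case: (eqVneq k i') => [->|_] //; rewrite e2 e4 eqxx.
move=> H; have : \sum_(0 <= k < 5) ((k == i) + (k == i')) <= \sum_(0 <= k < 5)
   (S (ln_of c k) k b == S (ln_of c k) k b') by apply: leq_sum_lt.
rewrite big_split /= => H2 E; move: H2; rewrite E.
rewrite (eq_bigr (fun k => nat_of_bool (i == k))); last by move=> k _; rewrite eq_sym.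
rewrite [X in _ + X](eq_bigr (fun k => nat_of_bool (i' == k))); last by move=> k _; rewrite eq_sym.
by rewrite !sum_eq_lt Hi Hi'.
Qed.

Lemma dir_bound c i s : c < 21 -> i < 5 -> s < 4 ->
  weight n (ln_of c i) + 4 * dir_count c i s <= 24 + n c.
Proof.
move=> Hc Hi Hs; have := segment_bound (cap (ln_of_lt c i)) Hi Hs.
by rewrite total_count ?ln_of_lt // class_sum_count ?ln_of_lt // pt_of_ln_of.
Qed.

Definition dir_max (c i : nat) : nat :=
  maxn (maxn (dir_count c i 0) (dir_count c i 1)) (maxn (dir_count c i 2) (dir_count c i 3)).

Lemma dir_max_bound c i : c < 21 -> i < 5 ->
  weight n (ln_of c i) + 4 * dir_max c i <= 24 + n c.
Proof.
move=> Hc Hi; have B s := @dir_bound c i s Hc Hi; rewrite /dir_max.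
by have := B 0 isT; have := B 1 isT; have := B 2 isT; have := B 3 isT; lia.
Qed.

Lemma dir_max_sum c : c < 21 -> 4 * \sum_(0 <= i < 5) dir_max c i <= 36 + n c.
Proof.
move=> Hc; have : \sum_(0 <= i < 5) (weight n (ln_of c i) + 4 * dir_max c i) <=
  \sum_(0 <= i < 5) (24 + n c) by apply: leq_sum_lt => i; apply: dir_max_bound.
rewrite sum_nat_const_nat big_split /= weight_pencil // -big_distrr /=; lia.
Qed.

(** In each direction the square sum is at most [n] times the maximum. For nonempty classes the
    second moment gives [n + 4] as a lower bound for the sum of the maxima, and four times that sum
    is at most [36 + n]. *)
Lemma class_le6 c : c < 21 -> n c <= 6.
Proof.
move=> Hc; have := dir_max_sum Hc; have := class_second_moment Hc.
have : \sum_(0 <= i < 5) dir_sqr c i <= \sum_(0 <= i < 5) dir_max c i * n c.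
  apply: leq_sum_lt => i Hi; rewrite -(dir_count_sum Hc Hi) /dir_sqr /class_sqr.
  rewrite -!/(dir_count _ _ _) /dir_max !mulnDr.
  by do 3?apply: leq_add; rewrite expnS expn1 leq_mul2r; apply/orP; right; lia.
by rewrite -big_distrl /=; move: (\sum_(_ <= _ < _) _) (\sum_(_ <= _ < _) _); nia.
Qed.

(** Five points on four segments make every maximum at least 2, while the five maxima sum to at most
    10. *)
Lemma dir_max2 c i s : c < 21 -> i < 5 -> s < 4 -> 4 < n c -> dir_count c i s <= 2.
Proof.
move=> Hc Hi Hs n5; have := class_le6 Hc => n6.
have U k : k < 5 -> 2 <= dir_max c k.
  by move=> Hk; have := dir_count_sum Hc Hk; rewrite /dir_max; lia.
have := dir_max_sum Hc; rewrite sum_nat5.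
have := U 0 isT; have := U 1 isT; have := U 2 isT; have := U 3 isT; have := U 4 isT.
have : dir_count c i s <= dir_max c i.
  by rewrite /dir_max; move: s Hs => [|[|[|[|//]]]] _; lia.
by move: i Hi => [|[|[|[|[|//]]]]] _; lia.
Qed.

Lemma sum5_tight (F : nat -> nat) k i : (forall i, i < 5 -> F i <= k) ->
  \sum_(0 <= i < 5) F i = 5 * k -> i < 5 -> F i = k.
Proof.
move=> H; rewrite sum_nat5 => E Hi.
have := H 0 isT; have := H 1 isT; have := H 2 isT; have := H 3 isT; have := H 4 isT.
by move: i Hi => [|[|[|[|[|//]]]]] _; lia.
Qed.

(** The second moment 45 is five times the largest possible square sum 9, so every direction attains
    it. For six points the numbers are 60 and 12. *)
Lemma class5_row c i : c < 21 -> i < 5 -> n c = 5 ->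
  perm_eq (seg_row (seg_count (ln_of c i)) i) row5.
Proof.
move=> Hc Hi n5.
have P k (Hk : k < 5) : dir_sqr c k <= 9 /\
    (dir_sqr c k = 9 -> perm_eq (seg_row (seg_count (ln_of c k)) k) row5).
  apply: profile5; rewrite -?/(dir_count _ _ _) ?dir_count_sum //;
  by apply: dir_max2; rewrite ?n5.
apply: (P i Hi).2; apply: (sum5_tight (F := dir_sqr c)) => //.
  by move=> k /P[].
by rewrite class_second_moment // n5.
Qed.

Lemma class6_row c i : c < 21 -> i < 5 -> n c = 6 ->
  perm_eq (seg_row (seg_count (ln_of c i)) i) row6.
Proof.
move=> Hc Hi n6.
have P k (Hk : k < 5) : dir_sqr c k <= 12 /\
    (dir_sqr c k = 12 -> perm_eq (seg_row (seg_count (ln_of c k)) k) row6).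
  apply: profile6; rewrite -?/(dir_count _ _ _) ?dir_count_sum //;
  by apply: dir_max2; rewrite ?n6.
apply: (P i Hi).2; apply: (sum5_tight (F := dir_sqr c)) => //.
  by move=> k /P[].
by rewrite class_second_moment // n6.
Qed.

Lemma class_heavy_row l j : l < 21 -> j < 5 -> 4 < n (pt_of l j) ->
  heavy_row (seg_row (seg_count l) j).
Proof.
move=> Hl Hj n5; have := class_le6 (pt_of_lt l j) => n6.
have [E|E] : n (pt_of l j) = 5 \/ n (pt_of l j) = 6 by lia.
  by have := class5_row (pt_of_lt l j) Hj E; rewrite ln_of_pt_of // /heavy_row => ->.
by have := class6_row (pt_of_lt l j) Hj E; rewrite ln_of_pt_of // /heavy_row orbC => ->.
Qed.

Lemma pos_bound c i : c < 21 -> i < 5 -> 4 < n c -> weight n (ln_of c i) <= 16 + n c.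
Proof.
move=> Hc Hi n5; have := dir_max_bound Hc Hi; have := dir_count_sum Hc Hi.
by rewrite /dir_max; lia.
Qed.

Lemma high_weights l : l < 21 -> high n l -> high_type (weights n l).
Proof.
move=> Hl; rewrite /high -total_count // -class_sums_count // => T.
have [k Hk n5] : exists2 k, k < 5 & 4 < n (pt_of l k).
  case: (boolP (has (fun k => 4 < n (pt_of l k)) (iota 0 5))).
    by case/hasP=> k; rewrite iotaP; exists k.
  move/hasPn=> H; move: T; rewrite total_count // weight5.
  have L k : k < 5 -> n (pt_of l k) <= 4 by rewrite -iotaP leqNgt => /H.
  have := L 0 isT; have := L 1 isT; have := L 2 isT; have := L 3 isT.
  by have := L 4 isT; lia.
apply: (high_line_type (cap Hl) T Hk); first exact: class_heavy_row.
move=> j Hj; rewrite class_sum_count //.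
by case: (leqP (n (pt_of l j)) 4) => [|/class_heavy_row]; [left|right; auto].
Qed.

Lemma no_four_fives l : l < 21 -> weight n l = 20 ->
  (forall j, j < 5 -> n (pt_of l j) = 0 \/ n (pt_of l j) = 5) -> False.
Proof.
move=> Hl W H.
have R j : j < 5 -> n (pt_of l j) = 5 -> perm_eq (seg_row (seg_count l) j) row5.
  by move=> Hj E; have := class5_row (pt_of_lt l j) Hj E; rewrite ln_of_pt_of.
have [k Hk n5] : exists2 k, k < 5 & n (pt_of l k) = 5.
  case: (H 0 isT) => E; last by exists 0.
  case: (H 1 isT) => E'; last by exists 1.
  by move: W; rewrite weight5 E E';
    case: (H 2 isT) => ->; case: (H 3 isT) => ->; case: (H 4 isT) => ->.
apply: (no_four_fives_and_zero (cap Hl) _ Hk (R k Hk n5)).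
  by rewrite total_count.
by move=> j Hj; rewrite class_sum_count //; case: (H j Hj) => E; [left|right; apply: R].
Qed.

Lemma class4_count c i s : c < 21 -> i < 5 -> s < 4 -> n c = 4 -> dir_count c i s <= 2.
Proof.
move=> Hc Hi Hs n4; rewrite leqNgt; apply/negP => w3.
have B := dir_bound Hc Hi Hs; rewrite n4 in B.
have W := weight_pencil size84 Hc; rewrite n4 sum_nat5 in W.
have W22 k : k < 5 -> weight n (ln_of c k) <= 22.
  by move=> _; apply: weight_le22 high_weights _ (ln_of_lt _ _).
have w4 : dir_count c i s <= 4.
  by have := dir_count_sum Hc Hi; rewrite n4; move: s Hs {w3 B} => [|[|[|[|//]]]] _; lia.
have := W22 0 isT; have := W22 1 isT; have := W22 2 isT; have := W22 3 isT.
have := W22 4 isT => a4 a3 a2 a1 a0.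
have [E|E] : dir_count c i s = 3 \/ dir_count c i s = 4 by lia.
(* With three points on a segment this direction has square sum 10, so among the other four three
   have 6 and one has 4. The line weights are then at most 16 + 3 * 20 + 22 = 98, short of 100. *)
- have D k : k < 5 -> k != i -> dir_sqr c k = 4 \/
      dir_sqr c k = 6 /\ weight n (ln_of c k) <= 20.
    move=> Hk ki; have := dir_support s Hc Hi Hk; rewrite eq_sym ki E sum_nat4 => /(_ isT).
    move=> sup; have := dir_count_sum Hc Hk; rewrite n4 => /profile4_spread/(_ sup)[E4|].
      by left.
    move=> [E6 x2]; right; split=> //.
    have b t := @dir_bound c k t Hc Hk; rewrite n4 in b.
    by case/or4P: x2 => /eqP x2;
      [have := b 0 isT|have := b 1 isT|have := b 2 isT|have := b 3 isT];
      rewrite x2; move: (weight _ _) => x; lia.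
  have Q : dir_sqr c i = 10.
    have := dir_count_sum Hc Hi; rewrite n4 /dir_sqr /class_sqr -!/(dir_count _ _ _).
    move: s Hs E {w3 B w4 D W W22 a0 a1 a2 a3 a4} => [|[|[|[|//]]]] _ -> /=;
    [move: (dir_count c i 1) (dir_count c i 2) (dir_count c i 3)
    |move: (dir_count c i 0) (dir_count c i 2) (dir_count c i 3)
    |move: (dir_count c i 0) (dir_count c i 1) (dir_count c i 3)
    |move: (dir_count c i 0) (dir_count c i 1) (dir_count c i 2)] => x y z E;
    by have := @sqr_sum1 x y z; move: (x ^ 2) (y ^ 2) (z ^ 2); lia.
  have := class_second_moment Hc; rewrite n4 sum_nat5.
  have := D 0 isT; have := D 1 isT; have := D 2 isT; have := D 3 isT; have := D 4 isT.
  by move: i Hi Q {w3 w4 D} E B => [|[|[|[|[|//]]]]] _ -> E B /= D4 D3 D2 D1 D0; lia.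
(* Four points on a segment bound that line weight by 12. The other four lines must weigh 22 and
   contain a six each, which is one six too many. *)
have := few_sixes size84 pos_bound high_weights.
have := pencil_of_lines (fun x => n x == 6 : nat) Hc; rewrite n4 /= muln0 addn0 => <-.
rewrite sum_nat5.
have six k : k < 5 -> weight n (ln_of c k) = 22 ->
    0 < \sum_(0 <= j < 5) (n (pt_of (ln_of c k) j) == 6).
  move=> Hk Wk; rewrite -(count_weights n (pred1 6)).
  have : high n (ln_of c k) by rewrite /high Wk.
  move/(high_weights (ln_of_lt c k))/or4P => T; move: Wk; rewrite /weight.
  by case: T => [||| /orP[]] P; rewrite (perm_sumn P) (permP P).
have := six 0 isT; have := six 1 isT; have := six 2 isT; have := six 3 isT.
have := six 4 isT; rewrite E in B.
by move: i Hi B {w3 w4 E} => [|[|[|[|[|//]]]]] _ B s4 s3 s2 s1 s0; lia.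
Qed.

Lemma class4_sqr l j : l < 21 -> j < 5 -> n (pt_of l j) = 4 ->
  4 <= class_sqr (seg_count l) j <= 8.
Proof.
move=> Hl Hj n4; have := class_sqr_ge (seg_count l) j; rewrite class_sum_count // n4 => ->.
have C s : s < 4 -> seg_count l j s <= 2.
  move=> Hs; have := class4_count (pt_of_lt l j) Hj Hs n4.
  by rewrite /dir_count ln_of_pt_of.
apply: sqr_le2; rewrite ?C //.
by have := class_sum_count Hl Hj; rewrite n4.
Qed.

Lemma class4_high_sqr l j : l < 21 -> j < 5 -> n (pt_of l j) = 4 -> high n l ->
  class_sqr (seg_count l) j <= 4.
Proof.
move=> Hl Hj n4 h; have C s : s < 4 -> seg_count l j s <= 1.
  move=> Hs; have := segment_bound (cap Hl) Hj Hs; move: h.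
  by rewrite /high total_count // class_sum_count // n4; lia.
by apply: sqr_le1; rewrite ?C.
Qed.

(** High lines have no excess. On the others, five fours give at most 32 - 20, four fours and a
    three at most 28 - 16, and three or fewer fours at most 4 each, always 12. Four fours and a
    class of at most two points may reach 16, which the last term covers. *)
Lemma excess_line l : l < 21 ->
  \sum_(0 <= j < 5) (n (pt_of l j) == 4) * (class_sqr (seg_count l) j - 4) <=
  12 * ~~ high n l + 4 * \sum_(0 <= j < 5) (n (pt_of l j) <= 2).
Proof.
move=> Hl; case: (boolP (high n l)) => h /=.
  rewrite big1_seq // => j /andP[_]; rewrite mem_index_iota => Hj.
  case: eqP => // n4; have := class4_high_sqr Hl Hj n4 h; lia.
have w20 : weight n l <= 20 by move: h; rewrite /high -leqNgt.
pose y j := (n (pt_of l j) == 4) * (class_sqr (seg_count l) j - 4).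
have Y j : j < 5 -> y j <= 4 * (n (pt_of l j) == 4).
  by move=> Hj; rewrite /y; case: eqP => // /(class4_sqr Hl Hj); lia.
rewrite -[leqLHS]/(\sum_(0 <= j < 5) y j).
case: (boolP (all (fun j => n (pt_of l j) == 4) (iota 0 5))) => [/allP H|].
  have {}H j : j < 5 -> n (pt_of l j) = 4 by rewrite -iotaP => /H/eqP.
  have [B _] := five_fours (cap Hl) (fun j Hj => etrans (class_sum_count Hl Hj) (H j Hj)).
  have Z j : j < 5 -> y j + 4 = class_sqr (seg_count l) j.
    by move=> Hj; rewrite /y H // eqxx mul1n subnK //; case/andP: (class4_sqr Hl Hj (H j Hj)).
  by move: B; rewrite /total_sqr -!Z // [\sum_(_ <= _ < _) y _]sum_nat5; move: (\sum_(_ <= _ < _) _) => p; lia.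
case/allPn=> j0; rewrite iotaP => Hj0 ne4.
case: (boolP (all (fun j => (j == j0) || (n (pt_of l j) == 4)) (iota 0 5))) => [/allP H|].
  have {}H j : j < 5 -> j != j0 -> n (pt_of l j) = 4.
    by rewrite -iotaP => /H /orP[->//|/eqP].
  have y0 : y j0 = 0 by rewrite /y (negbTE ne4).
  have v0 : n (pt_of l j0) <= 3.
    move: w20 ne4; rewrite weight5; move: (j0) Hj0 H => [|[|[|[|[|//]]]]] _ H;
    [rewrite (H 1) ?(H 2) ?(H 3) ?(H 4) //|rewrite (H 0) ?(H 2) ?(H 3) ?(H 4) //
    |rewrite (H 0) ?(H 1) ?(H 3) ?(H 4) //|rewrite (H 0) ?(H 1) ?(H 2) ?(H 4) //
    |rewrite (H 0) ?(H 1) ?(H 2) ?(H 3) //]; lia.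
  have [E3|v2] : n (pt_of l j0) = 3 \/ n (pt_of l j0) <= 2 by lia.
    have := @four_fours_and_three (seg_count l) j0 (cap Hl) Hj0.
    have Hn j : j < 5 -> class_sum (seg_count l) j = if j == j0 then 3 else 4.
      by move=> Hj; rewrite class_sum_count //; case: eqP => [->|/eqP] //; apply: H.
    have Z j : j < 5 -> j != j0 -> y j + 4 = class_sqr (seg_count l) j.
      move=> Hj jj; have E := H j Hj jj.
      by rewrite /y E eqxx mul1n subnK //; case/andP: (class4_sqr Hl Hj E).
    move=> /(_ Hn); rewrite /total_sqr [\sum_(_ <= _ < _) y _]sum_nat5; move: y0; move: (j0) Hj0 Z {H Hn ne4 v0 E3}.
    move=> [|[|[|[|[|//]]]]] _ Z -> /=;
    [rewrite -(Z 1) -?(Z 2) -?(Z 3) -?(Z 4) //|rewrite -(Z 0) -?(Z 2) -?(Z 3) -?(Z 4) //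
    |rewrite -(Z 0) -?(Z 1) -?(Z 3) -?(Z 4) //|rewrite -(Z 0) -?(Z 1) -?(Z 2) -?(Z 4) //
    |rewrite -(Z 0) -?(Z 1) -?(Z 2) -?(Z 3) //]; move: (class_sqr _ _) (\sum_(_ <= _ < _) _); lia.
  have {}Y j : j < 5 -> y j <= 4 * (j != j0).
    move=> Hj; case: (eqVneq j j0) => [->|_]; first by rewrite y0.
    by apply: leq_trans (Y j Hj) _; case: (n _ == 4).
  have P : 0 < \sum_(0 <= j < 5) (n (pt_of l j) <= 2).
    have : (n (pt_of l j0) <= 2) <= \sum_(0 <= j < 5) (n (pt_of l j) <= 2).
      by rewrite sum_nat5; move: (j0) Hj0 => [|[|[|[|[|//]]]]] _; lia.
    by rewrite v2.
  have := Y 0 isT; have := Y 1 isT; have := Y 2 isT; have := Y 3 isT; have := Y 4 isT.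
  rewrite [\sum_(_ <= _ < _) y _]sum_nat5; move: (\sum_(_ <= _ < _) _) P => p P.
  by move: (j0) Hj0 => [|[|[|[|[|//]]]]] _ /=; lia.
case/allPn=> j1; rewrite iotaP negb_or => Hj1 /andP[j10 ne4'].
have {}Y j : j < 5 -> y j <= 4 * ((j != j0) && (j != j1)).
  move=> Hj; apply: leq_trans (Y j Hj) _.
  case: (eqVneq j j0) => [->|_]; first by rewrite (negbTE ne4).
  case: (eqVneq j j1) => [->|_]; first by rewrite (negbTE ne4').
  by case: (n _ == 4).
have := Y 0 isT; have := Y 1 isT; have := Y 2 isT; have := Y 3 isT; have := Y 4 isT.
rewrite [\sum_(_ <= _ < _) y _]sum_nat5; move: (\sum_(_ <= _ < _) _) => p.
by move: (j0) (j1) Hj0 Hj1 j10 => [|[|[|[|[|//]]]]] [|[|[|[|[|//]]]]] _ _ //= _; lia.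
Qed.

Lemma class4_excess c : c < 21 -> n c = 4 -> \sum_(0 <= i < 5) (dir_sqr c i - 4) = 12.
Proof.
move=> Hc n4; have := class_second_moment Hc; rewrite n4 !sum_nat5.
have G i : i < 5 -> 4 <= dir_sqr c i.
  move=> Hi; have := class_sqr_ge (seg_count (ln_of c i)) i.
  by rewrite class_sum_count ?ln_of_lt // pt_of_ln_of // n4.
have := G 0 isT; have := G 1 isT; have := G 2 isT; have := G 3 isT.
by have := G 4 isT; lia.
Qed.

Lemma four_count : 12 * \sum_(0 <= c < 21) (n c == 4) <=
  \sum_(0 <= l < 21) (12 * ~~ high n l + 4 * \sum_(0 <= j < 5) (n (pt_of l j) <= 2)).
Proof.
apply: leq_trans (leq_sum_lt excess_line).
have -> := exchange_flags (fun l x j => (n x == 4) * (class_sqr (seg_count l) j - 4)).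
rewrite big_distrr /=; apply: leq_sum_lt => c Hc; rewrite -big_distrr /=.
by case: eqP => // n4; rewrite -/(dir_sqr c _) (class4_excess Hc n4).
Qed.

Theorem class_counts c : c < 21 -> n c = 4.
Proof.
move=> Hc; apply: (@eq_trans _ _ (4 - 0)) => //.
have L x : x < 21 -> n x <= 4.
  exact: (all_at_most_four size84 class_le6 pos_bound high_weights no_four_fives four_count).
have E : \sum_(0 <= x < 21) (4 - n x) = 0.
  have : \sum_(0 <= x < 21) (n x + (4 - n x)) = \sum_(0 <= x < 21) 4.
    by apply: eq_big_nat => x /andP[_ /L]; lia.
  by rewrite big_split /= size84 sum_nat_const_nat; lia.
have := L c Hc; move/eqP: E; rewrite sum_nat_seq_eq0 => /allP/(_ c).
by rewrite mem_index_iota Hc => /(_ isT) /=; lia.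
Qed.

(** Each class has second moment 32, so the 21 values [total_sqr] average 32, and the equality case
    of [five_fours] holds on every line class. *)
Theorem two_intersection_numbers l m : l < 21 -> m < 16 ->
  line_sum (seg_count l) m = 2 \/ line_sum (seg_count l) m = 6.
Proof.
have C l' : l' < 21 -> forall j, j < 5 -> class_sum (seg_count l') j = 4.
  by move=> Hl j Hj; rewrite class_sum_count // class_counts ?pt_of_lt.
have F l' (Hl' : l' < 21) := five_fours (cap Hl') (C l' Hl').
have T : \sum_(0 <= l' < 21) total_sqr (seg_count l') = \sum_(0 <= l' < 21) 32.
  have -> : \sum_(0 <= l' < 21) total_sqr (seg_count l') =
      \sum_(0 <= l' < 21) \sum_(0 <= j < 5) class_sqr (seg_count l') j.
    by apply: eq_bigr => l' _; rewrite sum_nat5.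
  have -> := exchange_flags (fun l x j => class_sqr (seg_count l) j).
  by apply: eq_big_nat => c /andP[_ Hc]; rewrite class_second_moment // class_counts.
have E : \sum_(0 <= l' < 21) (32 - total_sqr (seg_count l')) = 0.
  have : \sum_(0 <= l' < 21) (total_sqr (seg_count l') + (32 - total_sqr (seg_count l')))
    = \sum_(0 <= l' < 21) 32.
    by apply: eq_big_nat => x /andP[_ /F[]]; lia.
  by rewrite big_split /= T; lia.
move=> Hl; apply: (F l Hl).2; have [B _] := F l Hl.
move/eqP: E; rewrite sum_nat_seq_eq0 => /allP/(_ l).
by rewrite mem_index_iota Hl => /(_ isT) /=; lia.
Qed.

(* The hypothesis says that every point is on one or five of the 21 lines with
   index 0, as it is when these are the lines of a subplane PG(2,4). *)
Theorem no_arc_with_subplane :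
  (forall c b, c < 21 -> b < 16 ->
     \sum_(0 <= i < 5) (S (ln_of c i) i b == 0) = 1 \/
     \sum_(0 <= i < 5) (S (ln_of c i) i b == 0) = 5) -> False.
Proof.
move=> sub; pose k c b := \sum_(0 <= i < 5) (S (ln_of c i) i b == 0).
have lin (F : nat -> nat) a : \sum_(0 <= x < 21) (a + 4 * F x) =
    21 * a + 4 * \sum_(0 <= x < 21) F x.
  by rewrite big_split /= sum_nat_const_nat big_distrr.
have E1 : \sum_(0 <= l < 21) line_sum (seg_count l) 0 =
    42 + 4 * \sum_(0 <= l < 21) (line_sum (seg_count l) 0 == 6).
  rewrite -(lin _ 2); apply: eq_big_nat => l /andP[_ Hl].
  by case: (@two_intersection_numbers l 0 Hl isT) => ->.
have E2 : \sum_(0 <= l < 21) line_sum (seg_count l) 0 =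
    84 + 4 * \sum_(0 <= c < 21) \sum_(0 <= b < 16) (K c b && (k c b == 5)).
  have -> : \sum_(0 <= l < 21) line_sum (seg_count l) 0 =
      \sum_(0 <= l < 21) \sum_(0 <= j < 5) seg_count l j 0.
    by apply: eq_bigr => l _; rewrite sum_nat5.
  have -> := exchange_flags (fun l x j => seg_count l j 0).
  rewrite -size84 big_distrr -big_split /=; apply: eq_big_nat => c /andP[_ Hc].
  rewrite (eq_big_nat _ _ (F2 := fun i => \sum_(0 <= b < 16)
     (K c b && (S (ln_of c i) i b == 0)))); last first.
    by move=> i /andP[_ Hi]; rewrite -/(dir_count c i 0) dir_countE.
  rewrite exchange_big_nat /class_count big_distrr -big_split /=.
  apply: eq_big_nat => b /andP[_ Hb].
  case: (K c b) => /=; last by rewrite big1.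
  by rewrite -/(k c b); case: (sub c b Hc Hb); rewrite -/(k c b) => ->.
by move: E2; rewrite E1; lia.
Qed.

End Arc.

(** * From arcs of size 84 to arbitrary arcs *)

Lemma seg_count_mono (K K' : nat -> nat -> bool) S l :
  (forall c b, K' c b -> K c b) -> capped (seg_count K S l) -> capped (seg_count K' S l).
Proof.
move=> H C m Hm; apply: leq_trans (C m Hm); rewrite /line_sum.
have M j s : seg_count K' S l j s <= seg_count K S l j s.
  apply: leq_sum_lt => b _; case: (boolP (K' _ b)) => //= /H ->.
  by [].
by do 4!(apply: leq_add => //).
Qed.

Definition flags : seq (nat * nat) := [seq (c, b) | c <- iota 0 21, b <- iota 0 16].

Lemma sum_flags (P : nat * nat -> bool) :
  \sum_(0 <= c < 21) \sum_(0 <= b < 16) P (c, b) = size [seq p <- flags | P p].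
Proof.
rewrite size_filter -sum1_count [RHS]big_mkcond /flags big_allpairs_dep.
by rewrite /index_iota !subn0.
Qed.

Lemma uniq_flags : uniq flags. Proof. by vm_compute. Qed.

Lemma mem_flags c b : ((c, b) \in flags) = (c < 21) && (b < 16).
Proof.
apply/allpairsP/andP => [[[c' b'] [Hc Hb [-> ->]]]|[Hc Hb]]; first by rewrite -!iotaP.
by exists (c, b); rewrite !iotaP.
Qed.

Section Bounds.
Variables (K : nat -> nat -> bool) (S : nat -> nat -> nat -> nat).
Hypothesis S_lt : forall l j b, l < 21 -> j < 5 -> b < 16 -> S l j b < 4.
Hypothesis S_affine : forall c b b', c < 21 -> b < 16 -> b' < 16 ->
  \sum_(0 <= i < 5) (S (ln_of c i) i b == S (ln_of c i) i b') = 1 + 4 * (b == b').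
Hypothesis cap : forall l, l < 21 -> capped (seg_count K S l).

(** A larger arc has a class [c0] with more than four points. Cutting the arc down to 84 points,
    with all of [c0] kept, contradicts [class_counts]. *)
Theorem arc_size_bound : \sum_(0 <= c < 21) class_count K c <= 84.
Proof.
rewrite leqNgt; apply/negP => big.
have [c0 Hc0 n5] : exists2 c, c < 21 & 4 < class_count K c.
  case: (boolP (has (fun c => 4 < class_count K c) (iota 0 21))).
    by case/hasP=> c; rewrite iotaP; exists c.
  move/hasPn=> H; move: big; rewrite ltnNge => /negP[].
  apply: leq_trans (_ : _ <= \sum_(0 <= c < 21) 4) _; last by rewrite sum_nat_const_nat.
  by apply: leq_sum_lt => c Hc; rewrite leqNgt; apply: H; rewrite iotaP.
pose F := [seq p <- flags | K p.1 p.2].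
pose X := [seq p <- F | p.1 == c0]; pose Y := [seq p <- F | p.1 != c0].
have PXY : perm_eq (X ++ Y) F by rewrite perm_filterC.
have sF : 84 < size F.
  by rewrite -(sum_flags (fun p => K p.1 p.2)).
have uF : uniq F := filter_uniq _ uniq_flags.
have sX : size X <= 84.
  apply: (@leq_trans (size [seq (c0, b) | b <- iota 0 16])); last by rewrite size_map size_iota.
  apply: uniq_leq_size; first by rewrite filter_uniq.
  move=> [c b]; rewrite !mem_filter mem_flags => /and4P[/eqP E _ _ Hb].
  rewrite -[c]/((c, b).1) E.
  by apply: (map_f (fun b => (c0, b))); rewrite iotaP.
pose s := take 84 (X ++ Y); pose K' c b := (c, b) \in s.
have sub p : p \in s -> p \in F by move=> /mem_take; rewrite (perm_mem PXY).
have KK c b : K' c b -> K c b by move=> /sub; rewrite mem_filter => /andP[].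
have us : uniq s by rewrite take_uniq // (perm_uniq PXY).
have s84 : \sum_(0 <= c < 21) class_count K' c = 84.
  have ss : size s = 84 by rewrite size_takel // (perm_size PXY) ltnW.
  rewrite -{}ss; transitivity (size [seq p <- flags | p \in s]).
    exact: (sum_flags (fun p => p \in s)).
  apply: perm_size; apply: uniq_perm us _; first exact: filter_uniq uniq_flags.
  move=> p; rewrite mem_filter; case: (boolP (p \in s)) => // /sub.
  by rewrite mem_filter => /andP[].
have := class_counts S_lt S_affine s84
  (fun l Hl => seg_count_mono KK (cap Hl)) Hc0.
suff : class_count K c0 <= class_count K' c0 by move: n5; lia.
apply: leq_sum_lt => b Hb; case: (boolP (K c0 b)) => // kb; rewrite /K' /s take_cat.
rewrite ltnNge sX /= mem_cat mem_filter eqxx mem_filter /= kb mem_flags Hc0 Hb.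
by [].
Qed.

Theorem arc_size_bound_subplane :
  (forall c b, c < 21 -> b < 16 ->
     \sum_(0 <= i < 5) (S (ln_of c i) i b == 0) = 1 \/
     \sum_(0 <= i < 5) (S (ln_of c i) i b == 0) = 5) ->
  \sum_(0 <= c < 21) class_count K c < 84.
Proof.
move=> sub; rewrite ltn_neqAle arc_size_bound andbT; apply/eqP => s84.
exact: (no_arc_with_subplane S_lt S_affine s84 cap sub).
Qed.

End Bounds.

(** * A common model of the three rings *)

Definition f4 (k : nat) : F4 :=
  match k with 0 => F4_0 | 1 => F4_1 | 2 => F4_w | _ => F4_w2 end.
Definition f4_code (x : F4) : nat :=
  match x with F4_0 => 0 | F4_1 => 1 | F4_w => 2 | F4_w2 => 3 end.
Definition f4_eqb (x y : F4) : bool :=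
  match x, y with
  | F4_0, F4_0 | F4_1, F4_1 | F4_w, F4_w | F4_w2, F4_w2 => true
  | _, _ => false
  end.

(* The points of PG(2,4) along a Singer cycle, the lines numbered to match [pt_of],
   and for each line the 2x2 matrix over F_4 that takes the index (x, y) of a line in
   its class to the perturbation of the line coordinates, chosen so that the
   segments on that line are labelled by [dirv]. *)
Definition point_classes : seq (seq nat) :=
  [:: [:: 1; 0; 0]; [:: 0; 1; 0]; [:: 0; 0; 1]; [:: 1; 3; 3]; [:: 1; 2; 0];
      [:: 0; 1; 2]; [:: 1; 3; 1]; [:: 1; 0; 1]; [:: 1; 0; 3]; [:: 1; 2; 3];
      [:: 1; 2; 1]; [:: 1; 0; 2]; [:: 1; 1; 3]; [:: 1; 2; 2]; [:: 1; 1; 0];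
      [:: 0; 1; 1]; [:: 1; 3; 0]; [:: 0; 1; 3]; [:: 1; 3; 2]; [:: 1; 1; 2];
      [:: 1; 1; 1]].

Definition line_classes : seq (seq nat) :=
  [:: [:: 0; 0; 1]; [:: 1; 0; 0]; [:: 1; 2; 0]; [:: 1; 3; 1]; [:: 1; 3; 2];
      [:: 0; 1; 3]; [:: 1; 0; 1]; [:: 0; 1; 0]; [:: 1; 0; 2]; [:: 1; 3; 0];
      [:: 1; 1; 3]; [:: 1; 3; 3]; [:: 1; 2; 1]; [:: 1; 1; 2]; [:: 1; 1; 1];
      [:: 1; 2; 2]; [:: 1; 2; 3]; [:: 0; 1; 2]; [:: 1; 0; 3]; [:: 1; 1; 0];
      [:: 0; 1; 1]].

Definition line_frames : seq (seq nat) :=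
  [:: [:: 1; 0; 0; 3]; [:: 1; 0; 0; 3]; [:: 1; 3; 1; 0]; [:: 0; 1; 1; 1];
      [:: 1; 0; 3; 3]; [:: 1; 2; 1; 0]; [:: 1; 2; 0; 1]; [:: 1; 3; 2; 3];
      [:: 1; 3; 3; 0]; [:: 1; 2; 2; 1]; [:: 1; 1; 0; 2]; [:: 1; 3; 2; 0];
      [:: 1; 1; 1; 2]; [:: 0; 1; 3; 1]; [:: 1; 0; 1; 3]; [:: 0; 1; 2; 1];
      [:: 1; 0; 2; 3]; [:: 1; 1; 3; 0]; [:: 1; 1; 3; 2]; [:: 1; 2; 1; 1];
      [:: 0; 1; 3; 1]].

Record el := El { lo : F4; hi : F4 }.
Record el3 := El3 { co0 : el; co1 : el; co2 : el }.

Definition el_eqb (x y : el) : bool := f4_eqb (lo x) (lo y) && f4_eqb (hi x) (hi y).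
Definition el3_eqb (x y : el3) : bool :=
  [&& el_eqb (co0 x) (co0 y), el_eqb (co1 x) (co1 y) & el_eqb (co2 x) (co2 y)].
Definition el0 := El F4_0 F4_0.
Definition el1 := El F4_1 F4_0.

Definition els : seq el := [seq El (f4 a) (f4 b) | a <- iota 0 4, b <- iota 0 4].

Definition affine_table (t : seq (seq nat)) : bool :=
  all (fun b => all (fun b' =>
    Nat.eqb (foldr (fun i k => (if Nat.eqb (nth 0 (nth [::] t b) i) (nth 0 (nth [::] t b') i)
                                then 1 else 0) + k) 0 (iota 0 5))
            (if Nat.eqb b b' then 5 else 1))
  (iota 0 16)) (iota 0 16).

Section Model.
(* [El a b] stands for a + bX, or for a + 2b with Teichmueller digits a, b. The flag
   [kap] selects the Witt vector addition of G_4, the flag [tht] the twisted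
   multiplication of T_4; for S_4 both are off. *)
Variables (kap tht : bool).

Definition sq4 (x : F4) : F4 := F4_mul x x.
Definition tw (x : F4) : F4 := if tht then sq4 x else x.
(** The carry of two Teichmueller digits is the square root of their product; in F_4 squaring is its
    own inverse, so [sq4] is this root. *)
Definition eadd (x y : el) : el :=
  El (F4_add (lo x) (lo y))
     (F4_add (F4_add (hi x) (hi y)) (if kap then sq4 (F4_mul (lo x) (lo y)) else F4_0)).
Definition emul (x y : el) : el :=
  El (F4_mul (lo x) (lo y))
     (F4_add (F4_mul (lo x) (hi y)) (F4_mul (hi x) (tw (lo y)))).
Definition einv (x : el) : el :=
  El (sq4 (lo x)) (F4_mul (sq4 (lo x)) (F4_mul (hi x) (tw (sq4 (lo x))))).
Definition escale (v : el3) (r : el) : el3 :=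
  El3 (emul (co0 v) r) (emul (co1 v) r) (emul (co2 v) r).
Definition edot (l v : el3) : el :=
  eadd (eadd (emul (co0 l) (co0 v)) (emul (co1 l) (co1 v))) (emul (co2 l) (co2 v)).

(* The lifts of a normalised vector over F_4: its first nonzero coordinate
   stays 1. *)
Definition lift3 (v : seq nat) (b1 b2 : F4) : el3 :=
  match v with
  | [:: 0; 0; _] => El3 (El F4_0 b1) (El F4_0 b2) el1
  | [:: 0; _; z] => El3 (El F4_0 b1) el1 (El (f4 z) b2)
  | [:: _; y; z] => El3 el1 (El (f4 y) b1) (El (f4 z) b2)
  | _ => El3 el0 el0 el0
  end.

Definition point_rep (c b : nat) : el3 :=
  lift3 (nth [::] point_classes c) (f4 (b %/ 4)) (f4 (b %% 4)).

(** Under the twisted product a perturbation [b] meets a coordinate [c] as [b c^2]. Entering it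
    squared makes the whole term a square of the untwisted one, so the same frames serve all three
    rings. *)
Definition line_rep (l m : nat) : el3 :=
  let g := nth [::] line_frames l in
  let x := f4 (m %/ 4) in
  let y := f4 (m %% 4) in
  let co i j := F4_add (F4_mul (f4 (nth 0 g i)) x) (F4_mul (f4 (nth 0 g j)) y) in
  lift3 (nth [::] line_classes l) (tw (co 0 1)) (tw (co 2 3)).

Definition incident (l m : nat) (v : el3) : bool := el_eqb (edot (line_rep l m) v) el0.

(** Line [4 * s] has label [s] in direction 0, and line [s] has it in the other directions. If no
    line fits, [find] returns 4, which [seg_check] rejects. *)
Definition seg_of (l j b : nat) : nat :=
  let v := point_rep (pt_of l j) b in
  find (fun s => incident l (if j is 0 then 4 * s else s) v) (iota 0 4).

Definition seg_check : bool :=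
  all (fun l => all (fun j => all (fun b =>
    let s := seg_of l j b in
    let v := point_rep (pt_of l j) b in
    (s < 4) && all (fun m => if Nat.eqb s (dirv j m) then incident l m v else true)
                   (iota 0 16))
  (iota 0 16)) (iota 0 5)) (iota 0 21).

Definition seg_table (c : nat) : seq (seq nat) :=
  [seq [seq seg_of (ln_of c i) i b | i <- iota 0 5] | b <- iota 0 16].

Definition affine_check : bool := all (fun c => affine_table (seg_table c)) (iota 0 21).

(** Lines of index 0 have zero perturbation; over S_4 and T_4 they are the lines with coordinates in
    F_4. *)
Definition subplane_check : bool :=
  all (fun c => all (fun b =>
    let k := foldr (fun i k => (if Nat.eqb (seg_of (ln_of c i) i b) 0 then 1 else 0) + k)
                   0 (iota 0 5) in
    Nat.eqb k 1 || Nat.eqb k 5) (iota 0 16)) (iota 0 21).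

Definition is_unit (x : el) : bool := ~~ f4_eqb (lo x) F4_0.
Definition unimodular (v : el3) : bool :=
  [|| is_unit (co0 v), is_unit (co1 v) | is_unit (co2 v)].

Definition pivot (v : el3) : el :=
  if is_unit (co0 v) then co0 v else if is_unit (co1 v) then co1 v else co2 v.

(** The vector is normalised from the right at its first unit coordinate; the upper digits of the
    other two coordinates give the index in the class. *)
Definition decode (v : el3) : nat * nat :=
  let u := escale v (einv (pivot v)) in
  let c := find (fun a => match a with
             | [:: x; y; z] => [&& Nat.eqb x (f4_code (lo (co0 u))),
                 Nat.eqb y (f4_code (lo (co1 u))) & Nat.eqb z (f4_code (lo (co2 u)))]
             | _ => false end) point_classes in
  let b (x y : el) := 4 * f4_code (hi x) + f4_code (hi y) in
  (c, if is_unit (co0 v) then b (co1 u) (co2 u)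
      else if is_unit (co1 v) then b (co0 u) (co2 u) else b (co0 u) (co1 u)).

Definition decode_check : bool :=
  all (fun x => all (fun y => all (fun z =>
    let v := El3 x y z in
    if unimodular v then
      let d := decode v in
      [&& d.1 < 21, d.2 < 16 & el3_eqb (escale (point_rep d.1 d.2) (pivot v)) v]
    else true) els) els) els.

(** Together with [decode_check] this makes the 336 representatives a system of representatives of
    the points. *)
Definition unique_check : bool :=
  all (fun c => all (fun b => let v := point_rep c b in
    unimodular v && all (fun r => if is_unit r then
       let d := decode (escale v r) in Nat.eqb d.1 c && Nat.eqb d.2 b else true) els)
  (iota 0 16)) (iota 0 21).

Definition model_check : bool :=
  [&& seg_check, affine_check, decode_check & unique_check].
End Model.

Lemma model_G4 : model_check true false. Proof. by vm_compute. Qed.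
Lemma model_S4 : model_check false false. Proof. by vm_compute. Qed.
Lemma model_T4 : model_check false true. Proof. by vm_compute. Qed.
Lemma subplane_S4 : subplane_check false false. Proof. by vm_compute. Qed.
Lemma subplane_T4 : subplane_check false true. Proof. by vm_compute. Qed.

(** * Transfer from the model to free submodules *)

Import GRing.Theory.

Lemma f4_eqP x y : f4_eqb x y -> x = y. Proof. by case: x; case: y. Qed.

Lemma el_eqP x y : el_eqb x y -> x = y.
Proof. by case: x y => [a b] [c d] /andP[/f4_eqP /= -> /f4_eqP /= ->]. Qed.

Lemma el3_eqP x y : el3_eqb x y -> x = y.
Proof.
by case: x y => [a b c] [d e f] /and3P[/el_eqP /= -> /el_eqP /= -> /el_eqP /= ->].
Qed.

Lemma all_els (p : pred el) : all p els -> forall x, p x.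
Proof.
move=> H [a b]; move: H; rewrite /els /=; do 16?[case/andP=> ?]; move=> _.
by case: a; case: b.
Qed.

Lemma sum3 (V : nmodType) (F : 'I_3 -> V) (p q r : 'I_3) : uniq [:: p; q; r] ->
  (\sum_i F i = F p + F q + F r)%R.
Proof.
rewrite /= !inE negb_or andbT => /andP[/andP[pq pr] qr].
rewrite (bigD1 p) //= (bigD1 q) /= 1?eq_sym // (big_pred1 r) ?addrA // => i.
move: p q r i pq pr qr => [[|[|[|//]]] ?] [[|[|[|//]]] ?] [[|[|[|//]]] ?] [[|[|[|//]]] ?];
by rewrite -!val_eqE.
Qed.

Section PivotLine.
Variable R : finNzRingType.
Local Open Scope ring_scope.

(** The equation can be solved for coordinate [p], and the other two coordinates are free
    parameters. Coefficients act from the left, so this respects right scalars. *)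
Lemma pivot_line (l : vec R) (p q r : 'I_3) : uniq [:: p; q; r] -> l 0 p = 1 ->
  is_line [set v : vec R | \sum_i l 0 i * v 0 i == 0].
Proof.
move=> U lp.
pose mk (a b : R) : vec R :=
  \row_i (if i == p then - (l 0 q * a + l 0 r * b) else if i == q then a else b).
have mkE a b : rscale (mk 1 0) a + rscale (mk 0 1) b = mk a b.
  apply/rowP => i; rewrite !mxE; case: ifP => _.
    by rewrite !mulNr !mulr1 !mulr0 addr0 add0r -opprD.
  by case: ifP => _; rewrite ?mul1r ?mul0r ?addr0 ?add0r.
have [qp rp rq] : [/\ q == p = false, r == p = false & r == q = false].
  move: U; rewrite /= !inE negb_or andbT => /andP[/andP[pq pr] qr].
  by split; apply: negbTE; rewrite eq_sym.
have mkq a b : mk a b 0 q = a by rewrite mxE qp eqxx.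
have mkr a b : mk a b 0 r = b by rewrite mxE rp rq.
apply/existsP; exists (mk 1 0); apply/existsP; exists (mk 0 1); apply/andP; split.
  apply/injectiveP => -[a b] [a' b'] /=; rewrite !mkE => /rowP E.
  by have := E q; have := E r; rewrite !mkq !mkr => -> ->.
apply/eqP/setP => v; rewrite inE (sum3 _ U) lp mul1r; apply/eqP/imsetP => [E|].
  exists (v 0 q, v 0 r) => //=; rewrite mkE; apply/rowP => i; rewrite !mxE.
  case: eqP => [->|/eqP ip]; first by apply/eqP; rewrite -addr_eq0 addrA E.
  case: eqP => [->//|/eqP iq]; congr (v 0 _); apply/eqP; move: U ip iq.
  by move: p q r i {lp mk mkE qp rp rq mkq mkr E} => [[|[|[|//]]] ?] [[|[|[|//]]] ?]
     [[|[|[|//]]] ?] [[|[|[|//]]] ?]; rewrite -?val_eqE.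
case=> -[a b] _ ->; rewrite /= mkE mkq mkr mxE eqxx.
by rewrite -addrA addNr.
Qed.

End PivotLine.

Definition coord (v : el3) (i : 'I_3) : el :=
  match val i with 0 => co0 v | 1 => co1 v | _ => co2 v end.

Definition ord3_0 : 'I_3 := @Ordinal 3 0 isT.
Definition ord3_1 : 'I_3 := @Ordinal 3 1 isT.
Definition ord3_2 : 'I_3 := @Ordinal 3 2 isT.

Lemma forall_I3 (P : 'I_3 -> Prop) : P ord3_0 -> P ord3_1 -> P ord3_2 -> forall i, P i.
Proof.
move=> p0 p1 p2 [[|[|[|//]]] Hi]; [move: p0|move: p1|move: p2];
by congr P; apply: val_inj.
Qed.

Lemma lift3_pivot v b1 b2 : size v = 3 -> exists p q r : 'I_3,
  uniq [:: p; q; r] /\ coord (lift3 v b1 b2) p = el1.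
Proof.
case: v => [|x [|y [|z [|]]]] //= _.
case: x => [|x]; first case: y => [|y].
- by exists ord3_2, ord3_0, ord3_1.
- by exists ord3_1, ord3_0, ord3_2.
- by exists ord3_0, ord3_1, ord3_2.
Qed.

Lemma nat_eqbE x y : Nat.eqb x y = (x == y).
Proof. by elim: x y => [|x IH] [|y] //=; rewrite IH. Qed.

Lemma foldr_sum5 (P : nat -> bool) :
  foldr (fun i k => (if P i then 1 else 0) + k) 0 (iota 0 5) = \sum_(0 <= i < 5) P i.
Proof. by rewrite sum_nat5 /=; do 5!case: (P _). Qed.

Lemma pt_of_inj l j j' : l < 21 -> j < 5 -> j' < 5 -> pt_of l j = pt_of l j' -> j = j'.
Proof.
have : all (fun l => all (fun j => all (fun j' => (pt_of l j == pt_of l j') ==> (j == j'))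
  (iota 0 5)) (iota 0 5)) (iota 0 21) by vm_compute.
move=> /allP H Hl Hj Hj' E; have /allP/(_ j) := H l (etrans (iotaP _ _) Hl).
rewrite iotaP => /(_ Hj)/allP/(_ j'); rewrite iotaP => /(_ Hj').
by rewrite E eqxx => /eqP.
Qed.

Lemma affine_tableP t : affine_table t -> forall b b', b < 16 -> b' < 16 ->
  \sum_(0 <= i < 5) (nth 0 (nth [::] t b) i == nth 0 (nth [::] t b') i)
  = 1 + 4 * (b == b').
Proof.
move=> /allP/(_ _ (etrans (iotaP _ _) _)) H b b' Hb Hb'.
have /allP/(_ b') := H b Hb; rewrite iotaP => /(_ Hb').
rewrite foldr_sum5 !nat_eqbE => /eqP E; transitivity (if b == b' then 5 else 1).
  by rewrite -E; apply: eq_bigr => i _; rewrite nat_eqbE.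
by case: (b == b').
Qed.

Lemma nth_seg_table kap tht c b i : b < 16 -> i < 5 ->
  nth 0 (nth [::] (seg_table kap tht c) b) i = seg_of kap tht (ln_of c i) i b.
Proof.
by move=> Hb Hi; rewrite (nth_map 0) ?size_iota // nth_iota // (nth_map 0) ?size_iota // nth_iota.
Qed.

Section Transfer.
Variables (kap tht : bool) (R : finNzRingType) (phi : el -> R) (psi : R -> el).
Hypotheses (phiK : cancel phi psi) (psiK : cancel psi phi).
Hypotheses (phi0 : phi el0 = 0%R) (phi1 : phi el1 = 1%R).
Hypothesis phiD : forall x y, phi (eadd kap x y) = (phi x + phi y)%R.
Hypothesis phiM : forall x y, phi (emul tht x y) = (phi x * phi y)%R.
Hypothesis check : model_check kap tht.

Lemma checks : [/\ seg_check kap tht, affine_check kap tht, decode_check tht &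
  unique_check tht].
Proof. exact/and4P. Qed.

Definition vecof (v : el3) : vec R := (\row_i phi (coord v i))%R.

Lemma vecof_inj : injective vecof.
Proof.
move=> [x y z] [x' y' z'] /rowP E.
have := E ord3_0; have := E ord3_1; have := E ord3_2; rewrite !mxE /coord /=.
by move=> /(can_inj phiK) -> /(can_inj phiK) -> /(can_inj phiK) ->.
Qed.

Lemma vecof_surj x : exists v, x = vecof v.
Proof.
exists (El3 (psi (x 0%R ord3_0)) (psi (x 0%R ord3_1)) (psi (x 0%R ord3_2))).
by apply/rowP; apply: forall_I3; rewrite mxE /coord /= psiK.
Qed.

Lemma rscale_vecof v r : rscale (vecof v) (phi r) = vecof (escale tht v r).
Proof. by apply/rowP; apply: forall_I3; rewrite !mxE phiM. Qed.

Lemma rscaleA (x : vec R) (r s : R) : rscale (rscale x r) s = rscale x (r * s)%R.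
Proof. by apply/rowP => i; rewrite !mxE mulrA. Qed.

Definition pt (c b : nat) : {set vec R} :=
  [set rscale (vecof (point_rep c b)) r | r : R].

Lemma einvP r : is_unit r -> emul tht (einv tht r) r = el1 /\ emul tht r (einv tht r) = el1.
Proof. by rewrite /emul /einv /tw; case: r => [[] []] //= _; case: tht. Qed.

Lemma is_pointP P : is_point P -> exists c b, [/\ c < 21, b < 16 & P = pt c b].
Proof.
case/existsP=> x /andP[/injectiveP xinj /eqP ->].
have [v Ev] := vecof_surj x; subst x.
have uv : unimodular v.
  apply/negPn/negP => nu.
  (* A vector without unit coordinate is annihilated by the radical element [El F4_0 F4_1], so it
     generates no free module. *)
  have : rscale (vecof v) (phi (El F4_0 F4_1)) = rscale (vecof v) (phi el0).
    rewrite !rscale_vecof; congr vecof; move: nu; rewrite /unimodular /is_unit !negb_or !negbK.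
    case: v {xinj} => [[a b] [c d] [e f]] /= /and3P[/f4_eqP -> /f4_eqP -> /f4_eqP ->].
    by rewrite /escale /emul /tw /=; case: tht; case: b; case: d; case: f.
  by move=> /xinj /(can_inj phiK).
have [_ _ D _] := checks.
have := all_els (all_els (all_els D (co0 v)) (co1 v)) (co2 v); lazy beta zeta.
have -> : El3 (co0 v) (co1 v) (co2 v) = v by case: (v).
rewrite uv => /and3P[Hc Hb /el3_eqP E].
move: (decode tht v).1 (decode tht v).2 Hc Hb E => c b Hc Hb E.
exists c, b; split=> //; rewrite -{}E -rscale_vecof.
have pu : is_unit (pivot v).
  by move: uv; rewrite /unimodular /pivot; case: ifP => //= _; case: ifP.
have [iv vi] := einvP pu.
apply/setP => y; apply/imsetP/imsetP => -[r _ ->].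
  by exists (phi (pivot v) * r)%R => //; rewrite rscaleA.
exists (phi (einv tht (pivot v)) * r)%R => //.
by rewrite rscaleA mulrA -phiM vi phi1 mul1r.
Qed.

Lemma emul_unit x r : is_unit (emul tht x r) -> is_unit r.
Proof. by case: x r => [a b] [[] d] //; case: a. Qed.

Lemma escale1 v : escale tht v el1 = v.
Proof.
have E x : emul tht x el1 = x.
  by case: x => [a b]; rewrite /emul /tw /=; case: tht; case: a; case: b.
by case: v => x y z; rewrite /escale /= !E.
Qed.

Lemma pt_inj c b c' b' : c < 21 -> b < 16 -> c' < 21 -> b' < 16 ->
  pt c b = pt c' b' -> c = c' /\ b = b'.
Proof.
move=> Hc Hb Hc' Hb' E; have [_ _ _ /allP U] := checks.
have {}U d a : d < 21 -> a < 16 -> unimodular (point_rep d a) /\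
    forall r, is_unit r -> decode tht (escale tht (point_rep d a) r) = (d, a).
  move=> Hd Ha; have /allP/(_ a) := U d (etrans (iotaP _ _) Hd); rewrite iotaP => /(_ Ha).
  case/andP=> -> /all_els K; split=> // r ur; move: (K r); rewrite ur.
  by case: decode => x y /=; rewrite !nat_eqbE => /andP[/eqP -> /eqP ->].
have [u' D'] := U _ _ Hc' Hb'.
have : vecof (point_rep c' b') \in pt c b.
  rewrite E; apply/imsetP; exists (phi el1) => //.
  by rewrite rscale_vecof escale1.
case/imsetP=> r _; rewrite -(psiK r) rscale_vecof => /vecof_inj Er.
have ur : is_unit (psi r).
  by move: u'; rewrite Er /unimodular => /or3P[]; apply: emul_unit.
have := (U _ _ Hc Hb).2 _ ur; rewrite -Er.
by have := D' el1 isT; rewrite escale1 => -> [-> ->].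
Qed.

Definition ln (l m : nat) : {set vec R} :=
  [set v : vec R | (\sum_i vecof (line_rep tht l m) 0 i * v 0 i == 0)%R].

Lemma is_line_ln l m : l < 21 -> is_line (ln l m).
Proof.
move=> Hl; have [|p [q [r [U E]]]] := @lift3_pivot (nth [::] line_classes l)
  (tw tht (F4_add (F4_mul (f4 (nth 0 (nth [::] line_frames l) 0)) (f4 (m %/ 4)))
       (F4_mul (f4 (nth 0 (nth [::] line_frames l) 1)) (f4 (m %% 4)))))
  (tw tht (F4_add (F4_mul (f4 (nth 0 (nth [::] line_frames l) 2)) (f4 (m %/ 4)))
       (F4_mul (f4 (nth 0 (nth [::] line_frames l) 3)) (f4 (m %% 4))))).
  apply/eqP; have : all (fun v => size v == 3) line_classes by [].
  by move/allP; apply; apply: mem_nth.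
by apply: (pivot_line U); rewrite mxE [coord _ _]E phi1.
Qed.

Lemma incident_sub l m c b : incident kap tht l m (point_rep c b) -> pt c b \subset ln l m.
Proof.
move=> /el_eqP H; apply/subsetP => v /imsetP[r _ ->]; rewrite inE; apply/eqP.
have := congr1 phi H; rewrite phi0 /edot !phiD !phiM => E.
rewrite (@sum3 _ _ ord3_0 ord3_1 ord3_2) // !mxE !mulrA -!mulrDl /coord /=.
by rewrite E mul0r.
Qed.

Definition arc_of (A : {set {set vec R}}) (c b : nat) : bool := pt c b \in A.

Lemma seg_of_lt l j b : l < 21 -> j < 5 -> b < 16 -> seg_of kap tht l j b < 4.
Proof.
move=> Hl Hj Hb; have [/allP C _ _ _] := checks.
have /allP/(_ j) := C l (etrans (iotaP _ _) Hl); rewrite iotaP => /(_ Hj)/allP/(_ b).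
by rewrite iotaP => /(_ Hb)/andP[].
Qed.

Lemma seg_of_incident l j b m : l < 21 -> j < 5 -> b < 16 -> m < 16 ->
  seg_of kap tht l j b = dirv j m -> incident kap tht l m (point_rep (pt_of l j) b).
Proof.
move=> Hl Hj Hb Hm E; have [/allP C _ _ _] := checks.
have /allP/(_ j) := C l (etrans (iotaP _ _) Hl); rewrite iotaP => /(_ Hj)/allP/(_ b).
rewrite iotaP => /(_ Hb)/andP[_ /allP/(_ m)]; rewrite iotaP => /(_ Hm).
by rewrite E nat_eqbE eqxx.
Qed.

Lemma seg_of_affine c b b' : c < 21 -> b < 16 -> b' < 16 ->
  \sum_(0 <= i < 5) (seg_of kap tht (ln_of c i) i b == seg_of kap tht (ln_of c i) i b')
  = 1 + 4 * (b == b').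
Proof.
move=> Hc Hb Hb'; have [_ + _ _] := checks.
rewrite /affine_check => /allP/(_ c); rewrite iotaP => /(_ Hc)/affine_tableP/(_ _ _ Hb Hb') <-.
by apply: eq_big_nat => i /andP[_ Hi]; rewrite !nth_seg_table.
Qed.

Section Arc6.
Variable A : {set {set vec R}}.
Hypothesis arcA : is_arc 6 A.

(** The pairs counted by [line_sum] give distinct points of the arc, all contained in [ln l m]. *)
Lemma arc_capped l : l < 21 -> capped (seg_count (arc_of A) (seg_of kap tht) l).
Proof.
move=> Hl m Hm; have /andP[_ /forallP/(_ (ln l m))] := arcA.
rewrite is_line_ln //= => B; apply: leq_trans B.
pose P (p : nat * nat) := arc_of A (pt_of l p.1) p.2
   && (seg_of kap tht l p.1 p.2 == dirv p.1 m).
pose J := [seq (j, b) | j <- iota 0 5, b <- iota 0 16].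
have uJ : uniq J by vm_compute.
have J_lt p : p \in J -> p.1 < 5 /\ p.2 < 16.
  by case/allpairsP=> -[j b] [Hj Hb ->]; rewrite -!iotaP.
have -> : line_sum (seg_count (arc_of A) (seg_of kap tht) l) m = size [seq p <- J | P p].
  rewrite size_filter -sum1_count big_mkcond /J big_allpairs_dep /line_sum.
  rewrite -(sum_nat5 (fun j => seg_count (arc_of A) (seg_of kap tht) l j (dirv j m))).
  by rewrite /seg_count /index_iota !subn0.
rewrite -(size_map (fun p => pt (pt_of l p.1) p.2)) cardE; apply: uniq_leq_size.
  rewrite map_inj_in_uniq ?filter_uniq // => p p'; rewrite !mem_filter.
  move=> /andP[_ /J_lt[j5 b16]] /andP[_ /J_lt[j5' b16']] /pt_inj.
  move=> /(_ (pt_of_lt _ _) b16 (pt_of_lt _ _) b16') [Ej Eb].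
  have : p.1 = p'.1 by apply: (pt_of_inj Hl).
  by case: p p' Eb {j5 b16 j5' b16' Ej} => [x y] [x' y'] /= -> ->.
move=> X /mapP[p]; rewrite mem_filter => /andP[/andP[Ap /eqP Sp] /J_lt[j5 b16]] ->.
rewrite mem_enum inE [_ \in A]Ap; apply: incident_sub; exact: seg_of_incident.
Qed.

Lemma arc_card : #|A| <= \sum_(0 <= c < 21) class_count (arc_of A) c.
Proof.
have /andP[/forallP Ap _] := arcA.
have -> : \sum_(0 <= c < 21) class_count (arc_of A) c =
   size [seq p <- flags | arc_of A p.1 p.2] by rewrite -(sum_flags (fun p => arc_of A p.1 p.2)).
rewrite -(size_map (fun p => pt p.1 p.2)) cardE; apply: uniq_leq_size (enum_uniq _) _.
move=> X; rewrite mem_enum => XA; have := Ap X; rewrite XA => /is_pointP[c [b [Hc Hb E]]].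
apply/mapP; exists (c, b) => //; rewrite mem_filter mem_flags Hc Hb andbT /arc_of /=.
by rewrite -E XA.
Qed.

End Arc6.

Theorem m_arc_le84 : m_arc R 6 <= 84.
Proof.
apply/bigmax_leqP => A arcA; apply: leq_trans (arc_card arcA) _.
exact: (arc_size_bound seg_of_lt seg_of_affine (arc_capped arcA)).
Qed.

Theorem m_arc_lt84 : subplane_check kap tht -> m_arc R 6 < 84.
Proof.
(* The strict bound is read as at most 83, the form needed for a maximum over arcs. *)
move=> /allP sub; rewrite ltnS; apply/bigmax_leqP => A arcA.
rewrite -ltnS; apply: leq_ltn_trans (arc_card arcA) _.
apply: (arc_size_bound_subplane seg_of_lt seg_of_affine (arc_capped arcA)).
move=> c b Hc Hb; have /allP/(_ b) := sub c (etrans (iotaP _ _) Hc).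
rewrite iotaP => /(_ Hb); lazy beta zeta; rewrite foldr_sum5 !nat_eqbE.
have -> : \sum_(0 <= i < 5) Nat.eqb (seg_of kap tht (ln_of c i) i b) 0 =
   \sum_(0 <= i < 5) (seg_of kap tht (ln_of c i) i b == 0).
  by apply: eq_bigr => i _; rewrite nat_eqbE.
by case/orP=> /eqP; [left|right].
Qed.

End Transfer.

(** * The three rings *)

Definition phiS (x : el) : S4 := MkS4 (lo x) (hi x).
Definition psiS (x : S4) : el := El (s4a x) (s4b x).
Definition phiT (x : el) : T4 := MkT4 (lo x) (hi x).
Definition psiT (x : T4) : el := El (t4a x) (t4b x).

(* Teichmueller representatives: [w] is sent to the root [w] of X^2 + X + 1 and
   [w^2] to [-1 - w]. *)
Definition teich (x : F4) : G4 :=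
  match x with
  | F4_0 => MkG4 0 0 | F4_1 => MkG4 1 0 | F4_w => MkG4 0 1 | F4_w2 => MkG4 (-1) (-1)
  end%R.
Definition phiG (x : el) : G4 := (teich (lo x) + (teich (hi x) + teich (hi x)))%R.
Definition G4_eqb (x y : G4) : bool :=
  (val (g4a x) == val (g4a y)) && (val (g4b x) == val (g4b y)).
Lemma G4_eqP x y : G4_eqb x y -> x = y.
Proof. by case: x y => [a b] [c d] /andP[/eqP/val_inj /= -> /eqP/val_inj /= ->]. Qed.
Definition psiG (x : G4) : el :=
  nth el0 els (find (fun e => G4_eqb (phiG e) x) els).

Lemma phiGK : cancel phiG psiG.
Proof. by case=> [[] []]; vm_compute. Qed.

Lemma psiGK : cancel psiG phiG.
Proof.
suff H x : has (fun e => G4_eqb (phiG e) x) els.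
  by move=> x; apply/G4_eqP; have := nth_find el0 (H x).
case: x => [[[|[|[|[|//]]]] ia] [[|[|[|[|//]]]] ib]]; by vm_compute.
Qed.

Lemma phiGD x y : phiG (eadd true x y) = (phiG x + phiG y)%R.
Proof. by apply: G4_eqP; case: x => [[] []]; case: y => [[] []]; vm_compute. Qed.

Lemma phiGM x y : phiG (emul false x y) = (phiG x * phiG y)%R.
Proof. by apply: G4_eqP; case: x => [[] []]; case: y => [[] []]; vm_compute. Qed.

Lemma phiSD x y : phiS (eadd false x y) = (phiS x + phiS y)%R.
Proof. by congr MkS4; exact: addr0. Qed.

Lemma phiTD x y : phiT (eadd false x y) = (phiT x + phiT y)%R.
Proof. by congr MkT4; exact: addr0. Qed.

Lemma phiSM x y : phiS (emul false x y) = (phiS x * phiS y)%R.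
Proof. by []. Qed.

Lemma phiTM x y : phiT (emul true x y) = (phiT x * phiT y)%R.
Proof. by []. Qed.

Theorem theorem4p17 :
  (m_arc G4 6 <= 84)%N /\
  (m_arc S4 6 < 84)%N /\ (m_arc T4 6 < 84)%N.
Proof.
split; last split.
- by apply: (m_arc_le84 phiGK psiGK _ _ phiGD phiGM model_G4); apply: G4_eqP.
- have K : cancel phiS psiS by case.
  have K' : cancel psiS phiS by case.
  by apply: (m_arc_lt84 K K' _ _ phiSD phiSM model_S4 subplane_S4).
- have K : cancel phiT psiT by case.
  have K' : cancel psiT phiT by case.
  by apply: (m_arc_lt84 K K' _ _ phiTD phiTM model_T4 subplane_T4).
Qed.
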